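(* Let $q_n:V_n\to\mathbb{S}^2$, $n\ge 0$, be the rank $2$ algebraic vector bundles defined in the context. For every $n\geq 0$, the complexification $q_{n,\mathbb{C}}:V_{n,\mathbb{C}}\to\mathbb{S}^2_{\mathbb{C}}$ of $q_n:V_n\to\mathbb{S}^2$ is isomorphic, as an algebraic vector bundle, to the trivial vector bundle $\mathrm{pr}_1:\mathbb{S}^2_{\mathbb{C}}\times\mathbb{A}^2_{\mathbb{C}}\to\mathbb{S}^2_{\mathbb{C}}$.
   Context: Real/complex algebraic varieties are geometrically integral quasi-projective schemes of finite type over $\mathbb{R}$, resp. $\mathbb{C}$. For a real algebraic variety $X$, $X_{\mathbb{C}}=X\times_{\mathrm{Spec}\,\mathbb{R}}\mathrm{Spec}\,\mathbb{C}$ is its complexification, with canonical real structure $\sigma_X=\mathrm{id}_X\times\tau$, where $\tau$ is complex conjugation on $\mathrm{Spec}\,\mathbb{C}$. A real structure on a complex variety is an anti-regular involution (an $\mathbb{R}$-scheme involution lifting $\tau$). Descent construction: let $p:E\to X_{\mathbb{C}}$ be an algebraic vector bundle of rank $r$. The isomorphism $E\oplus\sigma_X^*E\to\sigma_X^*(E\oplus\sigma_X^*E)=\sigma_X^*E\oplus E$ exchanging the two summands defines a lift of $\sigma_X$ to a real structure $\tilde\sigma$ on the total space of $E\oplus\sigma_X^*E$ (on points over $s$, it sends $(e,e')\in E_s\oplus E_{\sigma_X(s)}$ to $(e',e)$ over $\sigma_X(s)$). The quotient $E_{\mathbb{R}}:=(E\oplus\sigma_X^*E)/\langle\tilde\sigma\rangle\to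 X=X_{\mathbb{C}}/\langle\sigma_X\rangle$ is an algebraic vector bundle of rank $2r$ on $X$. The bundles $V_n$: let $\mathbb{Q}^2=\{X^2+Y^2+Z^2-T^2=0\}\subset\mathbb{P}^3_{\mathbb{R}}$ and $\mathbb{S}^2=\mathbb{Q}^2\setminus\{T=0\}=\mathrm{Spec}(\mathbb{R}[x,y,z]/(x^2+y^2+z^2-1))$. The map $([x_0:x_1],[y_0:y_1])\mapsto[x_0y_1+x_1y_0:\,i(x_1y_0-x_0y_1):\,x_0y_0-x_1y_1:\,x_0y_0+x_1y_1]$ is an isomorphism $\psi:\mathbb{P}^1_{\mathbb{C}}\times\mathbb{P}^1_{\mathbb{C}}\to\mathbb{Q}^2_{\mathbb{C}}$, under which $\sigma_{\mathbb{Q}^2}$ corresponds to $\sigma=s_\Delta\circ(\sigma_{\mathbb{P}^1_{\mathbb{R}}}\times\sigma_{\mathbb{P}^1_{\mathbb{R}}})$, with $s_\Delta$ the exchange of the two factors. For $n\ge0$, let $L_n=\mathrm{pr}_1^*\mathcal{O}_{\mathbb{P}^1_{\mathbb{C}}}(n)$ on $\mathbb{P}^1_{\mathbb{C}}\times\mathbb{P}^1_{\mathbb{C}}\simeq\mathbb{Q}^2_{\mathbb{C}}$, let $p_{n,\mathbb{R}}:L_{n,\mathbb{R}}\to\mathbb{Q}^2$ be the rank $2$ vector bundle obtained from $L_n$ by the descent construction, and let $q_n:V_n\to\mathbb{S}^2$ be its restriction to $\mathbb{S}^2$. *)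

(* Defs.v *)
From HB Require Import structures.
From mathcomp Require Import all_boot all_order all_algebra.
From mathcomp Require Import all_classical reals.
From mathcomp Require Import complex.
From mathcomp Require Import mpoly ring.

Set Implicit Arguments.
Unset Strict Implicit.
Unset Printing Implicit Defensive.

Import Order.TTheory GRing.Theory Num.Theory.
Local Open Scope classical_set_scope.
Local Open Scope ring_scope.

(** Complex varieties are treated classically: a variety is its set of complex
    points with the Zariski topology and the sheaf of regular functions, which
    is a sheaf of C-valued functions, C = R[i].  [creg U f] says that the
    restriction of [f] to [U] is a regular function on the open set [U]; the
    values of [f] outside [U] are irrelevant. *)

Record cspace (R : realType) := CSpace {
  cpt :> Type;
  copen : set (set cpt);
  creg : set cpt -> set (cpt -> R[i]) }.

Definition regular_map (R : realType) (X Y : cspace R) (f : X -> Y) : Prop :=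
  forall U : set Y, copen U ->
    copen (f @^-1` U) /\
    forall g : Y -> R[i], creg U g -> creg (f @^-1` U) (g \o f).

Definition antiregular (R : realType) (X Y : cspace R) (f : X -> Y) : Prop :=
  forall U : set Y, copen U ->
    copen (f @^-1` U) /\
    forall g : Y -> R[i], creg U g ->
      creg (f @^-1` U) (fun x => conjc (g (f x))).

Record real_structure (R : realType) (X : cspace R) := RealStructure {
  rs :> X -> X;
  rsK : involutive rs;
  rs_anti : antiregular rs }.

(** The space whose regular functions are locally quotients of the given basic
    functions.  [B D h] says that [h] is a basic function with domain [D]; the
    sets [D `&` [set y | h y != 0]] generate the topology. *)

Definition ratopen (R : realType) (T : Type) (B : set T -> set (T -> R[i])) :
    set (set T) :=
  [set U | forall x, U x ->
     exists D h, [/\ B D h, D x, h x != 0 & D `&` [set y | h y != 0] `<=` U]].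

Definition ratspace (R : realType) (T : Type) (B : set T -> set (T -> R[i])) :
    cspace R :=
  @CSpace R T (ratopen B) (fun U f => ratopen B U /\ forall x, U x ->
    exists D g h, [/\ B D g, B D h, D x, h x != 0 &
      forall y, U y -> D y -> h y != 0 -> f y = g y / h y]).

Definition affine (R : realType) (m : nat) : cspace R :=
  ratspace (fun (D : set 'rV[R[i]]_m) (f : 'rV[R[i]]_m -> R[i]) => D = setT /\
    exists p : {mpoly R[i][m]}, forall x, f x = p.@[x 0]).

Lemma ratspace_anti (R : realType) T T' B B' (f : T -> T') :
  (forall D h, B' D h -> B (f @^-1` D) (fun x => conjc (h (f x)))) ->
  @antiregular R (ratspace B) (ratspace B') f.
Proof.
move=> fB.
have fo (U : set T') : ratopen B' U -> ratopen B (f @^-1` U).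
  move=> oU x /oU [D [h [BDh Dx hx sub]]].
  exists (f @^-1` D), (fun x => conjc (h (f x))); split=> //.
  - exact: fB.
  - by rewrite conjc_eq0.
  - by move=> y [/= Dy hy]; apply: sub; split=> //=; rewrite -conjc_eq0.
move=> U oU; split; first exact: fo.
move=> g [_ rg]; split; first exact: fo.
move=> x /rg [D [a [b [Ba Bb Dx bx gE]]]].
exists (f @^-1` D), (fun x => conjc (a (f x))), (fun x => conjc (b (f x))).
split=> //; try exact: fB; first by rewrite conjc_eq0.
move=> y Uy Dy; rewrite conjc_eq0 => hy.
by rewrite gE // rmorphM /= conjc_inv.
Qed.

(** Only used for locally closed [A]. *)
Definition subspace (R : realType) (X : cspace R) (A : set X) : cspace R :=
  @ratspace R A (fun D f => exists (U : set X) (g : X -> R[i]),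
    [/\ copen U, creg U g, D = [set x : A | U (val x)] &
        forall x : A, D x -> f x = g (val x)]).

Lemma subspace_anti (R : realType) (X X' : cspace R) (A : set X) (A' : set X')
    (f : X -> X') (f' : subspace A -> subspace A') :
  antiregular f -> (forall x, val (f' x) = f (val x)) -> antiregular f'.
Proof.
move=> af f'E; apply: ratspace_anti => D h [U [g [oU rg DE hE]]].
have [o1 /(_ g rg) r1] := af U oU.
exists (f @^-1` U), (fun x => conjc (g (f x))); split=> //.
  by apply/seteqP; split=> x; rewrite DE /= f'E.
by move=> x Dx; rewrite hE // f'E.
Qed.

Definition prodspace (R : realType) (X Y : cspace R) : cspace R :=
  @ratspace R (X * Y)%type (fun D F =>
    exists (U : set X) (V : set Y) (m : nat)
           (f : 'I_m -> X -> R[i]) (g : 'I_m -> Y -> R[i]),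
    [/\ copen U /\ copen V, forall i, creg U (f i), forall i, creg V (g i),
        D = [set z | U z.1 /\ V z.2] &
        forall z, D z -> F z = \sum_(i < m) f i z.1 * g i z.2]).

(** The same scheme with its structure morphism to Spec C composed with complex
    conjugation. *)
Definition conjspace (R : realType) (X : cspace R) : cspace R :=
  @CSpace R X (@copen R X) (fun U f => creg U (fun x => conjc (f x))).

(** The quotient of [T] by the equivalence relation with classes [e x]. *)
Definition quot (T : Type) (e : T -> set T) : Type := set_type (range e).

Definition cls (T : Type) (e : T -> set T) (x : T) : quot e :=
  SigSub (mem_set (imageT e x)).

Definition quotspace (R : realType) (X : cspace R) (e : X -> set X) : cspace R :=
  @CSpace R (quot e)
    (fun U => copen [set x | U (cls e x)])
    (fun U f => creg [set x | U (cls e x)] (fun x => f (cls e x))).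

Definition qrepr (T : Type) (e : T -> set T) (c : quot e) : T :=
  sval (cid2 (set_mem (valP c))).

Lemma qreprK (T : Type) (e : T -> set T) : cancel (@qrepr T e) (@cls T e).
Proof. by move=> c; apply: val_inj => /=; rewrite /qrepr; case: cid2. Qed.

Lemma quotspace_anti (R : realType) (X X' : cspace R) (e : X -> set X)
    (e' : X' -> set X') (f : X -> X') (f' : quotspace e -> quotspace e') :
  antiregular f -> (forall x, f' (cls e x) = cls e' (f x)) -> antiregular f'.
Proof.
move=> af f'E U oU; have [o1 r1] := af _ oU.
have UE : [set x | (f' @^-1` U) (cls e x)] = f @^-1` [set x | U (cls e' x)].
  by apply/funext => x; rewrite /preimage /mkset f'E.
split; first by rewrite /copen /= UE.
move=> g rg; rewrite /creg /= UE.
suff -> : (fun x => conjc (g (f' (cls e x)))) =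
  (fun x => conjc (g (cls e' (f x)))) by exact: (r1 (fun x => g (cls e' x)) rg).
by apply/funext => x; rewrite f'E.
Qed.

Definition cone (R : realType) (m : nat) : cspace R :=
  @subspace R (affine R m) [set x | x != 0].

Definition cvec (R : realType) (m : nat) (x : cone R m) : 'rV[R[i]]_m := val x.

Lemma cvec_neq0 (R : realType) (m : nat) (x : cone R m) : cvec x != 0.
Proof. exact: set_mem (valP x). Qed.

Definition mkcone (R : realType) (m : nat) (x : 'rV[R[i]]_m) (hx : x != 0) :
  cone R m :=
  @SigSub _ _ (mem [set x : 'rV[R[i]]_m | x != 0]) x (mem_set hx).

Definition scaling (R : realType) (m : nat) (x : cone R m) : set (cone R m) :=
  [set y | exists t : R[i], t != 0 /\ cvec y = t *: cvec x].

Definition projspace (R : realType) (m : nat) : cspace R :=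
  quotspace (@scaling R m.+1).

Definition pcls (R : realType) (m : nat) (x : cone R m.+1) : projspace R m :=
  cls (@scaling R m.+1) x.

(** A vector bundle is given by its total space, its fibres and their vector space
    structure: [fib x] is the fibre over [x], and [lincomb a u v w] says that
    [u], [v], [w] lie in one fibre and that w = a u + v there. *)

Record cbundle (R : realType) (X : cspace R) := CBundle {
  tot : cspace R;
  fib : X -> set tot;
  lincomb : R[i] -> tot -> tot -> tot -> Prop }.

Arguments fib {R X} c.
Arguments lincomb {R X} c.

Definition trivial_bundle (R : realType) (X : cspace R) (r : nat) : cbundle X :=
  @CBundle R X (prodspace X (affine R r))
    (fun x => [set z | z.1 = x])
    (fun a u v w => [/\ u.1 = v.1, w.1 = v.1 & w.2 = a *: u.2 + v.2]).

Definition bundle_isomorphic (R : realType) (X : cspace R) (E F : cbundle X) :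
    Prop :=
  exists (Phi : tot E -> tot F) (Psi : tot F -> tot E),
    [/\ cancel Phi Psi /\ cancel Psi Phi,
        regular_map Phi /\ regular_map Psi,
        forall x e, fib E x e <-> fib F x (Phi e) &
        forall a u v w,
          lincomb E a u v w <-> lincomb F a (Phi u) (Phi v) (Phi w)].

Definition pullback (R : realType) (X Y : cspace R) (f : Y -> X) (E : cbundle X) :
    cbundle Y :=
  @CBundle R Y (@subspace R (prodspace Y (tot E)) [set z | fib E (f z.1) z.2])
    (fun y => [set z | (val z).1 = y])
    (fun a u v w => [/\ (val u).1 = (val v).1, (val w).1 = (val v).1 &
       lincomb E a (val u).2 (val v).2 (val w).2]).

(** Transport along an isomorphism [f]. *)
Definition transport (R : realType) (X Y : cspace R) (f : X -> Y)
    (E : cbundle X) : cbundle Y :=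
  @CBundle R Y (tot E)
    (fun y => [set z | exists x, f x = y /\ fib E x z]) (lincomb E).

(** The total space of O(n) on P^1 is the quotient of (C^2 \ 0) x C by
    (x, v) ~ (t x, t^n v); homogeneous forms s of degree n are its sections
    [x] |-> [x, s(x)]. *)

Definition Oequiv (R : realType) (n : nat)
    (z : prodspace (cone R 2) (affine R 1)) :
    set (prodspace (cone R 2) (affine R 1)) :=
  [set z' | exists t : R[i],
    [/\ t != 0, cvec z'.1 = t *: cvec z.1 & z'.2 = t ^+ n *: z.2]].

Definition Ocls (R : realType) (n : nat) (x : cone R 2) (v : affine R 1) :
  quotspace (@Oequiv R n) := cls (@Oequiv R n) (x, v).

Definition Obundle (R : realType) (n : nat) : cbundle (projspace R 1) :=
  @CBundle R (projspace R 1) (quotspace (@Oequiv R n))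
    (fun c => [set z | exists x v, c = pcls x /\ z = Ocls n x v])
    (fun a u v w => exists (x : cone R 2) (s t : 'rV[R[i]]_1),
       [/\ u = Ocls n x s, v = Ocls n x t & w = Ocls n x (a *: s + t)]).

(** A real variety is a ringed space over R: its closed points [rpt], the
    Zariski opens [ropen], and a sheaf of R-algebras.  Sections over [U] are
    represented by C-valued functions on an auxiliary set [rgeo] lying over
    [rpt]; two of them are the same section when they agree over [U]. *)

Record rspace (R : realType) := RSpace {
  rpt : Type;
  rgeo : Type;
  rpr : rgeo -> rpt;
  ropen : set (set rpt);
  rsec : set rpt -> set (rgeo -> R[i]) }.

Arguments rpr {R} r.
Arguments rsec {R} r.

(** The quotient Y / <s>.  Its sections over [U] are the regular functions on the
    preimage of [U] that are invariant under f |-> conj o f o s. *)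

Definition realquot (R : realType) (Y : cspace R) (s : real_structure Y) :
    rspace R :=
  let e (y : Y) : set Y := [set y' | y' = y \/ y' = s y] in
  @RSpace R (quot e) Y (cls e)
    (fun U => copen [set y | U (cls e y)])
    (fun U f => creg [set y | U (cls e y)] f /\
       forall y, U (cls e y) -> f (s y) = conjc (f y)).

Definition ropensub (R : realType) (X : rspace R) (A : set (rpt X)) : rspace R :=
  @RSpace R A (rpr X @^-1` A)
    (fun y => SigSub (mem_set (set_mem (valP y) : A (rpr X (val y)))))
    (fun U => ropen [set val x | x in U])
    (fun U f => exists g, rsec X [set val x | x in U] g /\
       forall y, [set val x | x in U] (rpr X (val y)) -> f y = g (val y)).

(** [f] represents an element of the stalk at [x]. *)
Definition germ (R : realType) (X : rspace R) (x : rpt X) (f : rgeo X -> R[i]) :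
    Prop :=
  exists U : set (rpt X), [/\ ropen U, U x & rsec X U f].

(** A C-point of [X], i.e. a morphism Spec C -> X over R: a point [x] with a
    local homomorphism of R-algebras from the stalk at [x] to C.  It is
    normalized to be 0 on functions that represent no element of the stalk. *)

Record is_cpoint (R : realType) (X : rspace R) (x : rpt X)
    (phi : (rgeo X -> R[i]) -> R[i]) : Prop := IsCPoint {
  cp_stalk : forall (U : set (rpt X)) f g, ropen U -> U x -> rsec X U f ->
    (forall y, U (rpr X y) -> g y = f y) -> phi g = phi f;
  cp_add : forall f g, germ x f -> germ x g ->
    phi (fun y => f y + g y) = phi f + phi g;
  cp_mul : forall f g, germ x f -> germ x g ->
    phi (fun y => f y * g y) = phi f * phi g;
  cp_const : forall r : R, phi (fun=> real_complex R r) = real_complex R r;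
  cp_local : forall f, germ x f -> phi f != 0 -> exists g U,
    [/\ germ x g, ropen U, U x & forall y, U (rpr X y) -> f y * g y = 1];
  cp_junk : forall f, ~ germ x f -> phi f = 0 }.

Record cpoint (R : realType) (X : rspace R) := CPoint {
  cp_at : rpt X;
  cp_ev : (rgeo X -> R[i]) -> R[i];
  cpointP : is_cpoint cp_at cp_ev }.

(** The complexification X x_R C, as a set with functions: its closed points are
    the C-points of [X], and its regular functions are locally quotients of
    elements f + i g of the tensor product of O_X(U) with C over R. *)

Definition complexify (R : realType) (X : rspace R) : cspace R :=
  @ratspace R (cpoint X) (fun D F =>
    exists (U : set (rpt X)) (f g : rgeo X -> R[i]),
    [/\ ropen U, rsec X U f, rsec X U g, D = [set P | U (cp_at P)] &
        forall P, D P -> F P = cp_ev P f + 'i%C * cp_ev P g]).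

(** A bundle on a real variety.  [rfib y] is the set of elements of [rgeo rtot]
    over [y], so that a function f on [rgeo X] is pulled back to the functions
    equal to f y on [rfib y].  The linear structure is given by the sheaf
    [rlin] of fibrewise linear functions: [rlin U l] says that [l] is one on
    the preimage of [U]. *)

Record rbundle (R : realType) (X : rspace R) := RBundle {
  rtot : rspace R;
  rfib : rgeo X -> set (rgeo rtot);
  rlin : set (rpt X) -> set (rgeo rtot -> R[i]) }.

Arguments rfib {R X} r.
Arguments rlin {R X} r.

Definition rpreimage (R : realType) (X : rspace R) (T : rspace R)
    (F : rgeo X -> set (rgeo T)) (U : set (rpt X)) : set (rpt T) :=
  [set c | exists y z, [/\ F y z, rpr T z = c & U (rpr X y)]].

Definition rrestrict (R : realType) (X : rspace R) (V : rbundle X)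
    (A : set (rpt X)) : rbundle (ropensub A) :=
  @RBundle R (ropensub A) (ropensub (rpreimage (rfib V) A))
    (fun y => [set z | rfib V (val y) (val z)])
    (fun U l => exists l', rlin V [set val x | x in U] l' /\
       forall y z, U (rpr (ropensub A) y) -> rfib V (val y) (val z) ->
         l z = l' (val z)).

(** [lies_over v s]: the C-point [s] of [X] is the image of the C-point [v]. *)
Definition lies_over (R : realType) (X : rspace R) (V : rbundle X)
    (v : cpoint (rtot V)) (s : cpoint X) : Prop :=
  (exists y z, [/\ rpr X y = cp_at s, rpr (rtot V) z = cp_at v & rfib V y z]) /\
  forall (U : set (rpt X)) f g, ropen U -> U (cp_at s) -> rsec X U f ->
    (forall y z, U (rpr X y) -> rfib V y z -> g z = f y) ->
    cp_ev v g = cp_ev s f.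

(** The total space of a bundle is the spectrum of the symmetric algebra of its
    sheaf of linear functions; hence linear combinations of C-points in a fibre
    of the complexification are read on the values of linear functions. *)
Definition complexify_bundle (R : realType) (X : rspace R) (V : rbundle X) :
    cbundle (complexify X) :=
  @CBundle R (complexify X) (complexify (rtot V))
    (fun s => [set v | lies_over v s])
    (fun a u v w => exists s : cpoint X,
       [/\ lies_over u s, lies_over v s, lies_over w s &
           forall (U : set (rpt X)) l, ropen U -> U (cp_at s) -> rlin V U l ->
             cp_ev w l = a * cp_ev u l + cp_ev v l]).

(** As a scheme, s^*E is E itself, lying over Y through s o p and with
    conjugated scalars; its fibre over y is [fib E (s y)]. *)

Section Descent.
Context (R : realType) (Y : cspace R) (s : real_structure Y) (E : cbundle Y).

Let E2 : cspace R := prodspace (tot E) (conjspace (tot E)).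

Definition dset : set E2 :=
  [set z | exists y, fib E y z.1 /\ fib E (s y) z.2].

Definition dsum : cbundle Y :=
  let F (y : Y) : set (subspace dset) :=
    [set z | fib E y (val z).1 /\ fib E (s y) (val z).2] in
  @CBundle R Y (subspace dset) F
    (fun a u v w => [/\ exists y, [/\ F y u, F y v & F y w],
       lincomb E a (val u).1 (val v).1 (val w).1 &
       lincomb E (conjc a) (val u).2 (val v).2 (val w).2]).

Let swap2 (z : E2) : E2 := (z.2, z.1).

Lemma dset_swap (z : E2) : dset z -> dset (swap2 z).
Proof. by move=> [y [h1 h2]]; exists (s y); rewrite /= rsK. Qed.

Definition dswap_fun (z : tot dsum) : tot dsum :=
  SigSub (mem_set (dset_swap (set_mem (valP z)))).

Lemma dswap_funK : involutive dswap_fun.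
Proof. by move=> z; apply: val_inj => /=; rewrite /swap2 /=; case: (val z). Qed.

Lemma swap2_anti : antiregular swap2.
Proof.
apply: ratspace_anti => D F [U [V [m [f [g [[oU oV] rf rg -> FE]]]]]].
exists V, U, m, (fun i x => conjc (g i x)), (fun i x => conjc (f i x)); split.
- by split.
- exact: rg.
- by move=> i /=; under eq_fun do rewrite conjcK; exact: rf.
- by apply/seteqP; split=> z [].
- move=> z [hz1 hz2]; rewrite FE // raddf_sum.
  by apply: eq_bigr => i _ /=; rewrite rmorphM mulrC.
Qed.

Lemma dswap_anti : antiregular dswap_fun.
Proof. exact: (subspace_anti (f := swap2)) swap2_anti _. Qed.

(** The lift of [s] exchanging the two summands. *)
Definition dswap : real_structure (tot dsum) :=
  RealStructure dswap_funK dswap_anti.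

Definition descent : rbundle (realquot s) :=
  @RBundle R (realquot s) (realquot dswap) (fib dsum)
    (fun U l =>
       rsec (realquot dswap)
         (@rpreimage R (realquot s) (realquot dswap) (fib dsum) U) l /\
       forall a u v w y, U (rpr (realquot s) y) -> fib dsum y u ->
         lincomb dsum a u v w -> l w = a * l u + l v).

End Descent.

Section Quadric.
Context (R : realType).
Local Notation C := R[i].

Definition qform (x : 'rV[C]_4) : C :=
  let c k := x 0 (inord k) in c 0%N ^+ 2 + c 1%N ^+ 2 + c 2%N ^+ 2 - c 3%N ^+ 2.

Definition on_quadric : set (projspace R 3) :=
  [set c | exists x, c = pcls x /\ qform (cvec x) = 0].

Definition quadricC : cspace R := subspace on_quadric.

Let conjv (m : nat) : affine R m -> affine R m := map_mx conjc.

Lemma conjv_neq0 m (x : cone R m) : conjv (cvec x) != 0.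
Proof. by rewrite map_mx_eq0 cvec_neq0. Qed.

Let conjcone (m : nat) (x : cone R m) : cone R m := mkcone (conjv_neq0 x).

(** Complex conjugation of the homogeneous coordinates. *)
Definition pconj (m : nat) (c : projspace R m) : projspace R m :=
  pcls (conjcone (qrepr c)).

Lemma pcls_eq m (x y : cone R m.+1) (t : C) :
  t != 0 -> cvec y = t *: cvec x -> pcls y = pcls x.
Proof.
move=> t0 yx; apply: val_inj; apply/seteqP; split=> z [u [u0 zE]].
  by exists (u * t); rewrite mulf_neq0 // zE yx scalerA.
exists (u / t); rewrite mulf_neq0 ?invr_neq0 //; split=> //.
by rewrite zE yx scalerA mulfVK.
Qed.

Lemma qrepr_pcls m (x : cone R m.+1) :
  exists t : C, t != 0 /\ cvec (qrepr (pcls x)) = t *: cvec x.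
Proof.
have : scaling x (qrepr (pcls x)); last by [].
have /(congr1 val) /= <- := qreprK (pcls x).
by exists 1; rewrite oner_neq0 scale1r.
Qed.

Lemma pconj_cls m (x : cone R m.+1) : pconj (pcls x) = pcls (conjcone x).
Proof.
have [t [t0 tx]] := qrepr_pcls x.
apply: (@pcls_eq _ _ _ (conjc t)); first by rewrite conjc_eq0.
by rewrite /cvec /= -/(cvec _) tx /conjv map_mxZ.
Qed.

Lemma pclsP m (c : projspace R m) : exists x, c = pcls x.
Proof. by exists (qrepr c); rewrite [RHS]qreprK. Qed.

Lemma conjvK m : involutive (@conjv m).
Proof. by move=> x; apply/matrixP => i j; rewrite !mxE conjcK. Qed.

Lemma pconjK m : involutive (@pconj m).
Proof.
move=> c; have [x ->] := pclsP c; rewrite !pconj_cls; congr pcls.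
by apply: val_inj; exact: conjvK.
Qed.

Lemma conjv_anti m : antiregular (@conjv m).
Proof.
apply: ratspace_anti => D f [-> [p fE]]; split; first by [].
exists (\sum_(m0 <- msupp p) conjc p@_m0 *: 'X_[m0]) => x.
rewrite fE [in LHS]mevalE !raddf_sum; apply: eq_bigr => m0 _.
rewrite /= mevalZ mevalX rmorphM rmorph_prod; congr (_ * _).
by under eq_bigr => i _ do rewrite rmorphXn mxE /= conjcK.
Qed.

Lemma pconj_anti m : antiregular (@pconj m).
Proof.
apply: (quotspace_anti (f := @conjcone m.+1)); last exact: pconj_cls.
exact: (subspace_anti (f := @conjv m.+1)) (@conjv_anti _) _.
Qed.

Lemma on_quadric_pconj c : on_quadric c -> on_quadric (pconj c).
Proof.
move=> [x [-> qx]]; exists (conjcone x); split; first exact: pconj_cls.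
rewrite /qform /cvec /= /conjv !mxE -!rmorphXn -!rmorphD -rmorphB.
by move: qx; rewrite /qform /= => ->; rewrite rmorph0.
Qed.

Definition qconj_fun (w : quadricC) : quadricC :=
  SigSub (mem_set (on_quadric_pconj (set_mem (valP w)))).

Lemma qconj_funK : involutive qconj_fun.
Proof. by move=> w; apply: val_inj; exact: pconjK. Qed.

Lemma qconj_anti : antiregular qconj_fun.
Proof. exact: (subspace_anti (f := @pconj 3)) (@pconj_anti 3) _. Qed.

Definition qconj : real_structure quadricC :=
  RealStructure qconj_funK qconj_anti.

Definition quadric : rspace R := realquot qconj.

(** The locus T <> 0 in the quadric. *)
Definition sphere_set : set (rpt quadric) :=
  [set c | exists w x, [/\ c = rpr quadric w, val w = pcls x &
                           cvec x 0 (inord 3) != 0]].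

Definition sphere : rspace R := ropensub sphere_set.

(** [psivec] gives the isomorphism from P^1 x P^1 onto the complex quadric in
    homogeneous coordinates. *)
Definition psivec (x y : 'rV[C]_2) : 'rV[C]_4 :=
  let x0 := x 0 0 in let x1 := x 0 1 in
  let y0 := y 0 0 in let y1 := y 0 1 in
  \row_j [:: x0 * y1 + x1 * y0; 'i%C * (x1 * y0 - x0 * y1);
             x0 * y0 - x1 * y1; x0 * y0 + x1 * y1]`_j.

Lemma psivec_neq0 (x y : cone R 2) : psivec (cvec x) (cvec y) != 0.
Proof.
have sub0 (a b : C) : a + b = 0 -> a - b = 0 -> a = 0 /\ b = 0.
  move=> ab /subr0_eq ab'; move: ab; rewrite ab' -mulr2n => /eqP.
  by rewrite mulrn_eq0 /= => /eqP ->.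
apply/eqP => /rowP h.
have e k (lt_k : (k < 4)%N) := h (Ordinal lt_k).
have := (e 0%N isT, e 1%N isT, e 2%N isT, e 3%N isT); rewrite !mxE /=.
set x0 := cvec x 0 0; set x1 := cvec x 0 1.
set y0 := cvec y 0 0; set y1 := cvec y 0 1.
case=> [[[e0 /eqP]]]; rewrite mulf_eq0 => /orP[/eqP[/eqP]|/eqP e1].
  by rewrite oner_eq0.
move=> e2 e3; rewrite addrC in e0.
have [x1y0 x0y1] := sub0 _ _ e0 e1; have [x0y0 x1y1] := sub0 _ _ e3 e2.
have /negP := cvec_neq0 x; apply; apply/eqP/rowP => i; rewrite mxE.
have [j yj] : exists j, cvec y 0 j != 0 by exact/rV0Pn/cvec_neq0.
apply: (mulIf yj); rewrite mul0r.
have I2 (k : 'I_2) : k = 0 \/ k = 1.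
  by case: k => [[|[|//]]] lt_k; [left|right]; exact: val_inj.
by case: (I2 i) => ->; case: (I2 j) => ->.
Qed.

Lemma psivec_quadric (x y : cone R 2) :
  on_quadric (pcls (mkcone (psivec_neq0 x y))).
Proof.
exists (mkcone (psivec_neq0 x y)); split=> //.
rewrite /cvec /= /qform !mxE !inordK //= exprMn.
have -> : 'i%C ^+ 2 = -1 :> C by exact: sqr_i.
by ring.
Qed.

Definition psi (p : prodspace (projspace R 1) (projspace R 1)) : quadricC :=
  SigSub (mem_set (psivec_quadric (qrepr p.1) (qrepr p.2))).

Lemma psivecZ (t u : C) (x y : 'rV[C]_2) :
  psivec (t *: x) (u *: y) = (t * u) *: psivec x y.
Proof.
apply/rowP => j; rewrite !mxE; case: j => [[|[|[|[|//]]]] lt_j] /=; ring.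
Qed.

Lemma psi_cls (x y : cone R 2) :
  val (psi (pcls x, pcls y)) = pcls (mkcone (psivec_neq0 x y)).
Proof.
have [t [t0 tx]] := qrepr_pcls x; have [u [u0 uy]] := qrepr_pcls y.
apply: (@pcls_eq _ _ _ (t * u)); first by rewrite mulf_neq0.
by have := psivecZ t u (cvec x) (cvec y); rewrite -tx -uy; apply.
Qed.

Definition Lbundle (n : nat) : cbundle quadricC :=
  transport psi
    (pullback (fun p : prodspace (projspace R 1) (projspace R 1) => p.1)
       (Obundle R n)).

Definition LRbundle (n : nat) : rbundle quadric := descent qconj (Lbundle n).

Definition Vbundle (n : nat) : rbundle sphere :=
  rrestrict (LRbundle n) sphere_set.

End Quadric.

(* Main.v *)
Require Import Defs.
From mathcomp Require Import all_boot all_algebra.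
From mathcomp Require Import reals.
From mathcomp Require Import all_classical complex mpoly ring.

Set Implicit Arguments.
Unset Strict Implicit.
Unset Printing Implicit Defensive.

Import GRing.Theory.
Local Open Scope classical_set_scope.
Local Open Scope ring_scope.

(** Let (x, y) be a pair of homogeneous coordinates on P^1 x P^1. After
    complexification the descended bundle is O(n,0) + O(0,n): over the point
    psi (x, y) a point of it is a pair of a vector v of the first line and of a
    vector of the conjugate of O(n) at the conjugate of y, whose conjugate
    coordinate is u. On the affine sphere x_0 y_0 + x_1 y_1 does not vanish, and
    the coordinates can be chosen with x_0 y_0 + x_1 y_1 = 1; they are then unique
    up to (x, y, v, u) |-> (t x, t^-1 y, t^n v, t^-n u). The sections x_0^n and
    x_1^n of O(n,0) have no common zero, and the row (x_0^n, x_1^n) is completed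
    to a matrix of determinant 1 whose second row is (-y_1^n beta, y_0^n alpha),
    where alpha and beta come from a Bezout relation between the polynomials X^n
    and (1 - X)^n evaluated at X = x_0 y_0. This matrix is equivariant for the
    above changes of coordinates, so it gives a trivialization ([fibv], [fibu])
    with inverse ([coA], [coB]).

    The rest of the proof relates this computation to complexifications, which
    are made of C-points of stalks of real functions. By [cpoint_eval], a C-point
    of Y/s is the evaluation at a point of Y: its kernel is the maximal ideal, so
    it is one of the two conjugate embeddings of the residue field. By
    [openquot_eval_inj], this point of Y is unique when regular functions separate
    points. Regular functions on Y are sums f + i g with f and g invariant under
    the real structure, so they are regular on the complexification
    ([complexify_fun]); this applies to the affine coordinates of the sphere and
    to the two coordinates [dcoord] of the trivialization, which are regular on the
    total space by [dcoord_reg]. Conversely, a map into the total space is regular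
    once its image in the sphere and its coordinates are ([semireg_total]), since
    homogeneous coordinates can be recovered locally from the affine coordinates
    of the sphere. *)

(** * Spaces whose regular functions form a sheaf of rings *)

(** The functions of a space form a sheaf of rings of functions in which a
    function is invertible where it does not vanish. The field [reg_loc] combines
    gluing, restriction to smaller open sets and the irrelevance of the values
    taken outside the open set. *)
Record ringed (R : realType) (X : cspace R) : Prop := Ringed {
  openT : @copen R X setT;
  openI : forall U V : set X, copen U -> copen V -> copen (U `&` V);
  open_nbhd : forall U : set X,
    (forall x, U x -> exists V, [/\ copen V, V x & V `<=` U]) -> copen U;
  reg_open : forall (U : set X) f, creg U f -> copen U;
  reg_loc : forall (U : set X) f, copen U ->
    (forall x, U x -> exists V g,
      [/\ creg V g, V x & forall y, U y -> V y -> f y = g y]) -> creg U f;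
  regC : forall c, @creg R X setT (fun=> c);
  regD : forall (U : set X) f g, creg U f -> creg U g ->
    creg U (fun x => f x + g x);
  regM : forall (U : set X) f g, creg U f -> creg U g ->
    creg U (fun x => f x * g x);
  regV : forall (U : set X) f, creg U f ->
    creg (U `&` [set x | f x != 0]) (fun x => (f x)^-1) }.

Section Ringed.
Context (R : realType) (X : cspace R) (rX : ringed X).
Implicit Types U V : set X.

Lemma reg_eq U f g : creg U f -> (forall x, U x -> g x = f x) -> creg U g.
Proof.
move=> rf fg; apply: reg_loc (reg_open rX rf) _ => // x Ux.
by exists U, f; split=> // y Uy _; exact: fg.
Qed.

Lemma reg_sub U V f : copen V -> creg U f -> V `<=` U -> creg V f.
Proof.
by move=> oV rf VU; apply: reg_loc oV _ => // x Vx; exists U, f; split=> //; exact: VU.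
Qed.

Lemma reg_cst U c : copen U -> creg U (fun=> c).
Proof. by move=> oU; apply: reg_sub (regC rX c) _. Qed.

Lemma regN U f : creg U f -> creg U (fun x => - f x).
Proof.
move=> rf; apply: reg_eq (regM rX (reg_cst (-1) (reg_open rX rf)) rf) _ => x _.
by rewrite mulN1r.
Qed.

Lemma regB U f g : creg U f -> creg U g -> creg U (fun x => f x - g x).
Proof. by move=> rf rg; apply: regD => //; exact: regN. Qed.

Lemma regX U f n : creg U f -> creg U (fun x => f x ^+ n).
Proof.
move=> rf; elim: n => [|n IHn].
  by apply: reg_eq (reg_cst 1 (reg_open rX rf)) _ => x _; rewrite expr0.
by apply: reg_eq (regM rX rf IHn) _ => x _; rewrite exprS.
Qed.

Lemma reg_sum I (r : seq I) U (F : I -> X -> R[i]) : copen U ->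
  (forall i, creg U (F i)) -> creg U (fun x => \sum_(i <- r) F i x).
Proof.
move=> oU rF; elim: r => [|i r IHr].
  by apply: reg_eq (reg_cst 0 oU) _ => x _; rewrite big_nil.
by apply: reg_eq (regD rX (rF i) IHr) _ => x _; rewrite big_cons.
Qed.

Lemma reg_prod I (r : seq I) U (F : I -> X -> R[i]) : copen U ->
  (forall i, creg U (F i)) -> creg U (fun x => \prod_(i <- r) F i x).
Proof.
move=> oU rF; elim: r => [|i r IHr].
  by apply: reg_eq (reg_cst 1 oU) _ => x _; rewrite big_nil.
by apply: reg_eq (regM rX (rF i) IHr) _ => x _; rewrite big_cons.
Qed.

Lemma reg_horner U (p : {poly R[i]}) f : creg U f -> creg U (fun x => p.[f x]).
Proof.
move=> rf; have oU := reg_open rX rf.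
apply: (@reg_eq U (fun x => \sum_(i <- iota 0 (size p)) p`_i * f x ^+ i)).
  by apply: reg_sum => // i; apply: regM (reg_cst _ oU) (regX _ rf).
by move=> x _; rewrite horner_coef -(big_mkord xpredT (fun i => p`_i * f x ^+ i)) /index_iota subn0.
Qed.

Lemma reg_inv U f : creg U f -> (forall x, U x -> f x != 0) ->
  creg U (fun x => (f x)^-1).
Proof.
move=> rf f0; apply: reg_sub (regV rX rf) _ => //; first exact: reg_open rf.
by move=> x Ux; split=> //; exact: f0.
Qed.

Lemma open_neq0 U f : creg U f -> copen (U `&` [set x | f x != 0]).
Proof. by move=> rf; exact: reg_open (regV rX rf). Qed.

End Ringed.

(** Conditions on a class of basic functions under which the functions that are
    locally quotients of basic ones have the sheaf property: products of
    denominators must stay basic, on the intersection of the two domains. *)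
Record ring_basis (R : realType) (T : Type) (B : set T -> set (T -> R[i])) :
    Prop := RingBasis {
  basis_cover : forall x, exists D f, B D f /\ D x;
  basis_cst : forall D f c, B D f -> B D (fun=> c);
  basisD : forall D f D' f', B D f -> B D' f' ->
    B (D `&` D') (fun x => f x + f' x);
  basisM : forall D f D' f', B D f -> B D' f' ->
    B (D `&` D') (fun x => f x * f' x) }.

Lemma ringed_ratspace (R : realType) (T : Type) (B : set T -> set (T -> R[i])) :
  ring_basis B -> ringed (ratspace B).
Proof.
move=> [Bc B1 BD BM].
have oT : ratopen B setT.
  move=> x _; have [D [f [Bf Dx]]] := Bc x.
  by exists D, (fun=> 1); split=> //; [exact: B1 Bf|exact: oner_neq0].
have oI U V : ratopen B U -> ratopen B V -> ratopen B (U `&` V).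
  move=> oU oV x [/oU [D [h [Bh Dx hx hU]]] /oV [E [k [Bk Ex kx kV]]]].
  exists (D `&` E), (fun y => h y * k y).
  split=> //; [exact: BM|by rewrite mulf_neq0|].
  by move=> y [[Dy Ey]] /=; rewrite mulf_eq0 negb_or => /andP[hy ky]; split;
    [exact: hU|exact: kV].
have rO U f : @creg R (ratspace B) U f ->
    ratopen B (U `&` [set x | f x != 0]) /\
    creg (U `&` [set x | f x != 0] : set (ratspace B)) (fun x => (f x)^-1).
  move=> [oU rf].
  have o : ratopen B (U `&` [set x | f x != 0]).
    move=> x [Ux /= fx]; have [D [h [Bh Dx hx hU]]] := oU x Ux.
    have [E [a [b [Ba Bb Ex bx fE]]]] := rf x Ux.
    have ax : a x != 0 by apply: contraNneq fx => ax; rewrite fE // ax mul0r.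
    exists (D `&` (E `&` E)), (fun y => h y * (a y * b y)).
    split=> //; [by apply: (BM) => //; exact: BM|by rewrite !mulf_neq0|].
    move=> y [[Dy [Ey _]]] /=; rewrite !mulf_eq0 !negb_or => /and3P[hy ay by0].
    have Uy : U y by exact: hU.
    by split=> //=; rewrite fE // mulf_neq0 // invr_neq0.
  split=> //; split=> // x [Ux /= fx].
  have [E [a [b [Ba Bb Ex bx fE]]]] := rf x Ux.
  have ax : a x != 0 by apply: contraNneq fx => ax; rewrite fE // ax mul0r.
  (* b/a rewritten as b^2/(a b), so that the new denominator vanishes
     wherever the formula a/b for f is not available *)
  exists (E `&` E), (fun y => b y * b y), (fun y => a y * b y).
  split; [exact: BM|exact: BM|by []|by rewrite mulf_neq0|].
  move=> y [Uy _] [Ey _]; rewrite mulf_eq0 negb_or => /andP[ay by0].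
  by rewrite fE // invf_div -mulf_div divff // mulr1.
split=> //.
- move=> U oU x /oU [V [oV Vx VU]].
  have [D [h [Bh Dx hx hV]]] := oV x Vx.
  by exists D, h; split=> //; exact: subset_trans VU.
- by move=> U f [].
- move=> U f oU fl; split=> // x Ux.
  have [V [g [[oV rg] Vx fg]]] := fl x Ux.
  have [D [h [Bh Dx hx hV]]] := oV x Vx.
  have [E [a [b [Ba Bb Ex bx gE]]]] := rg x Vx.
  (* the factor h restricts the formula to V, where f is known to be g *)
  exists (E `&` D), (fun y => a y * h y), (fun y => b y * h y).
  split; [exact: BM|exact: BM|by []|by rewrite mulf_neq0|].
  move=> y Uy [Ey Dy]; rewrite mulf_eq0 negb_or => /andP[by0 hy].
  have Vy : V y by exact: hV.
  by rewrite fg // gE // -mulf_div divff // mulr1.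
- move=> c; split=> // x _; have [D [f [Bf Dx]]] := Bc x.
  exists D, (fun=> c), (fun=> 1).
  by split=> //; [exact: B1 Bf|exact: B1 Bf|exact: oner_neq0|move=> *; rewrite divr1].
- move=> U f g [oU rf] [_ rg]; split=> // x Ux.
  have [D [a [b [Ba Bb Dx bx fE]]]] := rf x Ux.
  have [E [a' [b' [Ba' Bb' Ex bx' gE]]]] := rg x Ux.
  exists ((D `&` E) `&` (D `&` E)), (fun y => a y * b' y + b y * a' y), (fun y => b y * b' y).
  split=> //; first by apply: (BD); exact: BM.
  + by rewrite setIid; exact: BM.
  + by rewrite mulf_neq0.
  + move=> y Uy [[Dy Ey] _]; rewrite mulf_eq0 negb_or => /andP[by0 by1].
    by rewrite fE // gE // addf_div // [a' y * _]mulrC.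
- move=> U f g [oU rf] [_ rg]; split=> // x Ux.
  have [D [a [b [Ba Bb Dx bx fE]]]] := rf x Ux.
  have [E [a' [b' [Ba' Bb' Ex bx' gE]]]] := rg x Ux.
  exists (D `&` E), (fun y => a y * a' y), (fun y => b y * b' y).
  split; [exact: BM|exact: BM|by []|by rewrite mulf_neq0|].
  move=> y Uy [Dy Ey]; rewrite mulf_eq0 negb_or => /andP[by0 by1].
  by rewrite fE // gE // mulf_div.
- by move=> U f /rO[].
Qed.

Lemma ring_basis_affine (R : realType) m :
  ring_basis (fun (D : set 'rV[R[i]]_m) (f : 'rV[R[i]]_m -> R[i]) => D = setT /\
    exists p : {mpoly R[i][m]}, forall x, f x = p.@[x 0]).
Proof.
split.
- by move=> x; exists setT, (fun=> 0); split=> //; split=> //; exists 0 => y; rewrite meval0.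
- by move=> D f c [-> _]; split=> //; exists c%:MP => y; rewrite mevalC.
- move=> D f D' f' [-> [p fp]] [-> [q f'q]]; rewrite setIT; split=> //.
  by exists (p + q) => y; rewrite mevalD fp f'q.
- move=> D f D' f' [-> [p fp]] [-> [q f'q]]; rewrite setIT; split=> //.
  by exists (p * q) => y; rewrite mevalM fp f'q.
Qed.

Lemma ringed_affine (R : realType) m : ringed (affine R m).
Proof. exact/ringed_ratspace/ring_basis_affine. Qed.

Lemma ringed_subspace (R : realType) (X : cspace R) (A : set X) :
  ringed X -> ringed (subspace A).
Proof.
move=> rX; apply: ringed_ratspace; split.
- move=> x; exists setT, (fun=> 0); split=> //; exists setT, (fun=> 0).
  by split=> //; [exact: openT|exact: regC].
- move=> D f c [U [g [oU rg -> _]]]; exists U, (fun=> c).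
  by split=> //; exact: reg_cst.
- move=> D f D' f' [U [g [oU rg -> fg]]] [V [h [oV rh -> f'h]]].
  have oI : copen (U `&` V) by exact: openI.
  exists (U `&` V), (fun x => g x + h x); split=> //.
  + by apply: regD => //; [apply: reg_sub rg _|apply: reg_sub rh _] => // ? [].
  + by move=> x [Ux Vx]; rewrite fg // f'h.
- move=> D f D' f' [U [g [oU rg -> fg]]] [V [h [oV rh -> f'h]]].
  have oI : copen (U `&` V) by exact: openI.
  exists (U `&` V), (fun x => g x * h x); split=> //.
  + by apply: regM => //; [apply: reg_sub rg _|apply: reg_sub rh _] => // ? [].
  + by move=> x [Ux Vx]; rewrite fg // f'h.
Qed.

Definition prod_basis (R : realType) (X Y : cspace R) (D : set (X * Y))
    (F : X * Y -> R[i]) : Prop :=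
  exists (U : set X) (V : set Y) (m : nat)
           (f : 'I_m -> X -> R[i]) (g : 'I_m -> Y -> R[i]),
    [/\ copen U /\ copen V, forall i, creg U (f i), forall i, creg V (g i),
        D = [set z | U z.1 /\ V z.2] &
        forall z, D z -> F z = \sum_(i < m) f i z.1 * g i z.2].

(** Allowing any finite index type makes the sum and the product of two basic
    functions basic: the index types are the sum and the product. *)
Lemma prod_basisI (R : realType) (X Y : cspace R) (I : finType) (U : set X)
    (V : set Y) (f : I -> X -> R[i]) (g : I -> Y -> R[i]) F :
  copen U -> copen V -> (forall i, creg U (f i)) -> (forall i, creg V (g i)) ->
  (forall z, U z.1 -> V z.2 -> F z = \sum_i f i z.1 * g i z.2) ->
  prod_basis [set z | U z.1 /\ V z.2] F.
Proof.
move=> oU oV rf rg FE.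
exists U, V, #|I|, (fun i => f (enum_val i)), (fun i => g (enum_val i)).
split=> // z [Uz Vz]; rewrite FE //.
by rewrite (reindex _ (onW_bij _ (enum_val_bij I))).
Qed.

Lemma ring_basis_prod (R : realType) (X Y : cspace R) :
  ringed X -> ringed Y -> ring_basis (@prod_basis R X Y).
Proof.
move=> rX rY; split.
- move=> x; exists [set z | setT z.1 /\ setT z.2], (fun=> 0); split=> //.
  apply: (@prod_basisI _ _ _ 'I_0 _ _ (fun _ _ => 0) (fun _ _ => 0)).
  + exact: openT.
  + exact: openT.
  + by move=> _; exact: regC.
  + by move=> _; exact: regC.
  + by move=> z _ _; rewrite big_ord0.
- move=> D f c [U [V [m [F [G [[oU oV] _ _ -> _]]]]]].
  apply: (@prod_basisI _ _ _ 'I_1 _ _ (fun _ _ => c) (fun _ _ => 1)) => //.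
  + by move=> _; exact: reg_cst.
  + by move=> _; exact: reg_cst.
  + by move=> z _ _; rewrite big_ord1 mulr1.
- move=> D f D' f' [U [V [m [F [G [[oU oV] rF rG -> fE]]]]]].
  move=> [U' [V' [m' [F' [G' [[oU' oV'] rF' rG' -> f'E]]]]]].
  have -> : [set z | U z.1 /\ V z.2] `&` [set z | U' z.1 /\ V' z.2] =
            [set z | (U `&` U') z.1 /\ (V `&` V') z.2].
    by apply/seteqP; split=> z /= [[? ?] [? ?]].
  have oUU := openI rX oU oU'; have oVV := openI rY oV oV'.
  apply: (@prod_basisI _ _ _ ('I_m + 'I_m')%type _ _
    (fun i => match i with inl i => F i | inr i => F' i end)
    (fun i => match i with inl i => G i | inr i => G' i end)) => //.
  + by case=> i; [apply: reg_sub (rF i) _|apply: reg_sub (rF' i) _] => // ? [].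
  + by case=> i; [apply: reg_sub (rG i) _|apply: reg_sub (rG' i) _] => // ? [].
  + by move=> z [Uz Uz'] [Vz Vz']; rewrite big_sumType /= fE // f'E.
- move=> D f D' f' [U [V [m [F [G [[oU oV] rF rG -> fE]]]]]].
  move=> [U' [V' [m' [F' [G' [[oU' oV'] rF' rG' -> f'E]]]]]].
  have -> : [set z | U z.1 /\ V z.2] `&` [set z | U' z.1 /\ V' z.2] =
            [set z | (U `&` U') z.1 /\ (V `&` V') z.2].
    by apply/seteqP; split=> z /= [[? ?] [? ?]].
  have oUU := openI rX oU oU'; have oVV := openI rY oV oV'.
  apply: (@prod_basisI _ _ _ ('I_m * 'I_m')%type _ _
    (fun i x => F i.1 x * F' i.2 x) (fun i x => G i.1 x * G' i.2 x)) => //.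
  + by move=> i; apply: regM => //;
      [apply: reg_sub (rF _) _|apply: reg_sub (rF' _) _] => // ? [].
  + by move=> i; apply: regM => //;
      [apply: reg_sub (rG _) _|apply: reg_sub (rG' _) _] => // ? [].
  + move=> z [Uz Uz'] [Vz Vz']; rewrite fE // f'E // big_distrlr pair_big /=.
    by apply: eq_bigr => i _; rewrite mulrACA.
Qed.

Lemma ringed_prodspace (R : realType) (X Y : cspace R) :
  ringed X -> ringed Y -> ringed (prodspace X Y).
Proof. by move=> rX rY; exact/ringed_ratspace/ring_basis_prod. Qed.

Lemma ringed_conjspace (R : realType) (X : cspace R) :
  ringed X -> ringed (conjspace X).
Proof.
move=> rX; split.
- exact: (openT rX).
- exact: (openI rX).
- exact: (open_nbhd rX).
- by move=> U f; apply: (reg_open rX).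
- move=> U f oU fl; apply: (reg_loc rX) => // x /fl [V [g [rg Vx fg]]].
  by exists V, (fun x => conjc (g x)); split=> // y Uy Vy; rewrite fg.
- by move=> c; exact: (regC rX).
- move=> U f g rf rg; apply: (reg_eq rX (regD rX rf rg)) => x _.
  by rewrite rmorphD.
- move=> U f g rf rg; apply: (reg_eq rX (regM rX rf rg)) => x _.
  by rewrite rmorphM.
- move=> U f /(regV rX).
  have -> : U `&` [set x | conjc (f x) != 0] = U `&` [set x | f x != 0].
    by apply/seteqP; split=> x /= []; rewrite conjc_eq0.
  by move=> rf; apply: (reg_eq rX rf) => x _ /=; rewrite conjc_inv.
Qed.

Lemma ringed_quotspace (R : realType) (X : cspace R) (e : X -> set X) :
  ringed X -> ringed (quotspace e).
Proof.
move=> rX; split.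
- exact: (openT rX).
- by move=> U V; exact: (openI rX).
- move=> U oU; apply: (open_nbhd rX) => x /oU [V [oV Vx VU]].
  by exists [set x | V (cls e x)]; split=> // y; exact: VU.
- by move=> U f; apply: (reg_open rX).
- move=> U f oU fl; apply: (reg_loc rX) => // x /fl [V [g [rg Vx fg]]].
  by exists [set x | V (cls e x)], (fun x => g (cls e x)); split=> // y; exact: fg.
- by move=> c; exact: (regC rX).
- by move=> U f g; exact: (regD rX).
- by move=> U f g; exact: (regM rX).
- by move=> U f; exact: (regV rX).
Qed.

Lemma ratspace_reg (R : realType) T (B : set T -> set (T -> R[i])) D f :
  ring_basis B -> B D f -> @creg R (ratspace B) D f.
Proof.
move=> [_ B1 _ _] Bf; split=> [x Dx|x Dx].
  exists D, (fun=> 1); split=> //; [exact: B1 Bf|exact: oner_neq0].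
exists D, f, (fun=> 1).
by split=> //; [exact: B1 Bf|exact: oner_neq0|move=> *; rewrite divr1].
Qed.

(** * Maps that are regular, or antiregular, on an open set *)

(** With [c] the identity these maps are the regular ones, with [c] the complex
    conjugation the antiregular ones; the conjugate summand of the descended
    bundle calls for both. Values outside of [N] are irrelevant, which allows for
    local liftings to homogeneous coordinates. *)
Definition semireg (R : realType) (c : {rmorphism R[i] -> R[i]})
    (X Y : cspace R) (N : set X) (f : X -> Y) : Prop :=
  forall U : set Y, copen U ->
    copen (N `&` f @^-1` U) /\
    forall g, creg U g -> creg (N `&` f @^-1` U) (fun x => c (g (f x))).

Lemma semireg_regular (R : realType) (X Y : cspace R) (f : X -> Y) :
  semireg idfun setT f -> regular_map f.
Proof. by move=> rf U /rf; rewrite setTI. Qed.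

Section Semireg.
Context (R : realType) (c : {rmorphism R[i] -> R[i]}).
Implicit Types X Y Z : cspace R.

Lemma semireg_ratspace X T (B : set T -> set (T -> R[i])) (N : set X)
    (f : X -> ratspace B) :
  ringed X ->
  (forall D h, B D h -> creg (N `&` f @^-1` D) (fun x => c (h (f x)))) ->
  semireg c N f.
Proof.
move=> rX fB.
have fo (U : set T) : ratopen B U -> copen (N `&` f @^-1` U).
  move=> oU; apply: (open_nbhd rX) => x [Nx /oU [D [h [BDh Dx hx sub]]]].
  exists ((N `&` f @^-1` D) `&` [set x | c (h (f x)) != 0]); split.
  - exact: open_neq0 (fB _ _ BDh).
  - by split=> //=; rewrite fmorph_eq0.
  - by move=> y [[Ny Dy] /=]; rewrite fmorph_eq0 => hy; split=> //; exact: sub.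
move=> U oU; split; first exact: fo.
move=> g [_ rg]; apply: (reg_loc rX); first exact: fo.
move=> x [Nx /rg [D [a [b [Ba Bb Dx bx gE]]]]].
exists ((N `&` f @^-1` D) `&` [set x | c (b (f x)) != 0]).
exists (fun x => c (a (f x)) * (c (b (f x)))^-1); split.
- apply: (regM rX); last exact: (regV rX (fB _ _ Bb)).
  apply: (reg_sub rX _ (fB _ _ Ba)); first exact: open_neq0 (fB _ _ Bb).
  by move=> ? [].
- by split=> //=; rewrite fmorph_eq0.
- by move=> y [Ny Uy] [[_ Dy] /=]; rewrite fmorph_eq0 => hy; rewrite gE // fmorph_div.
Qed.

Lemma semireg_reg X Y (N : set X) (f : X -> Y) U g :
  semireg c N f -> copen U -> creg U g -> (forall x, N x -> U (f x)) ->
  creg N (fun x => c (g (f x))).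
Proof.
move=> rf oU rg NU; have [_ /(_ g rg)] := rf U oU.
by rewrite setIidl.
Qed.

Lemma semireg_comp X Y Z (N : set X) (M : set Y) (f : X -> Y) (g : Y -> Z) :
  semireg c N f -> semireg idfun M g -> (forall x, N x -> M (f x)) ->
  semireg c N (fun x => g (f x)).
Proof.
move=> rf rg NM U oU; have [oV rV] := rg U oU; have [oW rW] := rf _ oV.
have E : N `&` (fun x => g (f x)) @^-1` U = N `&` f @^-1` (M `&` g @^-1` U).
  by apply/seteqP; split=> [x [Nx Ux]|x [Nx [Mx Ux]]]; split=> //; split=> //; exact: NM.
by rewrite E; split=> // h rh; exact: (rW _ (rV _ rh)).
Qed.

Lemma semireg_loc X Y (N : set X) (f : X -> Y) : ringed X ->
  (forall x, N x -> exists M f', [/\ copen M, M x, M `<=` N, semireg c M f' &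
     forall y, M y -> f y = f' y]) -> semireg c N f.
Proof.
move=> rX floc U oU.
have fo : copen (N `&` f @^-1` U).
  apply: (open_nbhd rX) => x [Nx Ux].
  have [M [f' [oM Mx MN rf' ff']]] := floc x Nx; have [oM' _] := rf' U oU.
  exists (M `&` f' @^-1` U); split=> //; first by split=> //=; rewrite -ff'.
  by move=> y [My Uy]; split; [exact: MN|rewrite /= ff'].
split=> // g rg; apply: (reg_loc rX) => // x [Nx Ux].
have [M [f' [oM Mx MN rf' ff']]] := floc x Nx; have [oM' rM'] := rf' U oU.
exists (M `&` f' @^-1` U), (fun x => c (g (f' x))); split=> //.
- exact: rM'.
- by split=> //=; rewrite -ff'.
- by move=> y _ [My _]; rewrite ff'.
Qed.

Lemma semireg_eq X Y (N : set X) (f f' : X -> Y) : ringed X -> copen N ->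
  semireg c N f' -> (forall x, N x -> f x = f' x) -> semireg c N f.
Proof. by move=> rX oN rf ff'; apply: semireg_loc => // x Nx; exists N, f'; split. Qed.

Lemma semireg_subspace X Y (A : set Y) (N : set X) (f : X -> subspace A) :
  ringed X -> semireg c N (fun x => val (f x)) -> semireg c N f.
Proof.
move=> rX rf; apply: semireg_ratspace => // D h [U [g [oU rg -> hE]]].
have [oN rN] := rf U oU; apply: (reg_eq rX (rN g rg)) => x [Nx Ux].
by rewrite hE.
Qed.

Lemma semireg_prodspace X Y Z (N : set X) (f : X -> prodspace Y Z) :
  ringed X -> semireg c N (fun x => (f x).1) -> semireg c N (fun x => (f x).2) ->
  semireg c N f.
Proof.
move=> rX r1 r2; apply: semireg_ratspace => // D h.
move=> [U [V [m [F [G [[oU oV] rF rG -> hE]]]]]].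
have [o1 rN1] := r1 U oU; have [o2 rN2] := r2 V oV.
set W := _ `&` _; have WE : W = (N `&` (fun x => (f x).1) @^-1` U) `&`
    (N `&` (fun x => (f x).2) @^-1` V).
  by apply/seteqP; split=> [x [Nx [Ux Vx]]|x [[Nx Ux] [_ Vx]]].
have oW : copen W by rewrite WE; exact: (openI rX).
apply: (@reg_eq _ _ rX _ (fun x =>
    \sum_i c (F i (f x).1) * c (G i (f x).2))).
  apply: (reg_sum rX) => // i; apply: (regM rX).
    by apply: (reg_sub rX) (rN1 _ (rF i)) _ => //; rewrite WE => ? [].
  by apply: (reg_sub rX) (rN2 _ (rG i)) _ => //; rewrite WE => ? [].
move=> x [Nx Dx]; rewrite hE // rmorph_sum.
by apply: eq_bigr => i _; rewrite rmorphM.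
Qed.

Lemma semireg_affine X m (N : set X) (f : X -> affine R m) :
  ringed X -> copen N -> (forall k, creg N (fun x => c (f x 0 k))) ->
  semireg c N f.
Proof.
move=> rX oN rf; apply: semireg_ratspace => // D h [-> [p hE]].
rewrite preimage_setT setIT.
apply: (@reg_eq _ _ rX _ (fun x => \sum_(m0 <- msupp p)
    c p@_m0 * \prod_i c (f x 0 i) ^+ m0 i)).
  apply: (reg_sum rX) => // m0; apply: (regM rX); first exact: (reg_cst rX).
  by apply: (reg_prod rX) => // i; exact: (regX rX).
move=> x _; rewrite hE mevalE rmorph_sum; apply: eq_bigr => m0 _.
rewrite rmorphM rmorph_prod; congr (_ * _).
by apply: eq_bigr => i _; rewrite rmorphXn.
Qed.

Lemma semireg_quotspace X Y (e : Y -> set Y) (N : set X) (f : X -> Y) :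
  semireg c N f -> semireg c N (fun x => cls e (f x) : quotspace e).
Proof.
move=> rf U oU; have [o r] := rf [set x | U (cls e x)] oU.
by split=> // g rg; exact: (r (fun x => g (cls e x))).
Qed.

End Semireg.

Section SemiregInstances.
Context (R : realType).
Implicit Types X Y Z : cspace R.

Lemma semireg_val X (A : set X) : ringed X ->
  semireg idfun setT (fun x : subspace A => val x : X).
Proof.
move=> rX U oU; rewrite setTI.
have r g : creg U g -> creg ((fun x : subspace A => val x) @^-1` U) (fun x => g (val x)).
  by move=> rg; split=> x Ux; [exists ((fun x : subspace A => val x) @^-1` U), (fun=> 1)|
    exists ((fun x : subspace A => val x) @^-1` U), (fun x => g (val x)), (fun=> 1)];
    (split=> //; first [exact: oner_neq0|by move=> ? []|by move=> *; rewrite divr1|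
      by exists U, (fun=> 1); split=> //; apply: (reg_cst rX)|
      by exists U, g; split]).
split=> //.
by case: (r (fun=> 1) (reg_cst rX _ oU)).
Qed.

Lemma semireg_fst X Y : ringed X -> ringed Y ->
  semireg idfun setT (fun z : prodspace X Y => z.1).
Proof.
move=> rX rY U oU; rewrite setTI.
have r g : creg U g -> @creg _ (prodspace X Y) (fst @^-1` U) (fun z => g z.1).
  move=> rg; have -> : fst @^-1` U = [set z : X * Y | U z.1 /\ setT z.2].
    by apply/seteqP; split=> // z [].
  apply: ratspace_reg (ring_basis_prod rX rY) _.
  apply: (@prod_basisI _ _ _ 'I_1 _ _ (fun _ x => g x) (fun _ _ => 1)) => //.
  - exact: openT.
  - by move=> _; exact: regC.
  - by move=> z _ _; rewrite big_ord1 mulr1.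
by split=> //; apply: (reg_open (ringed_prodspace rX rY)) (r (fun=> 1) (reg_cst rX _ oU)).
Qed.

Lemma semireg_snd X Y : ringed X -> ringed Y ->
  semireg idfun setT (fun z : prodspace X Y => z.2).
Proof.
move=> rX rY U oU; rewrite setTI.
have r g : creg U g -> @creg _ (prodspace X Y) (snd @^-1` U) (fun z => g z.2).
  move=> rg; have -> : snd @^-1` U = [set z : X * Y | setT z.1 /\ U z.2].
    by apply/seteqP; split=> // z [].
  apply: ratspace_reg (ring_basis_prod rX rY) _.
  apply: (@prod_basisI _ _ _ 'I_1 _ _ (fun _ _ => 1) (fun _ x => g x)) => //.
  - exact: openT.
  - by move=> _; exact: regC.
  - by move=> z _ _; rewrite big_ord1 mul1r.
by split=> //; apply: (reg_open (ringed_prodspace rX rY)) (r (fun=> 1) (reg_cst rY _ oU)).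
Qed.

Lemma affine_coord_reg m k :
  @creg R (affine R m) setT (fun x : 'rV_m => x 0 k).
Proof.
apply: ratspace_reg (ring_basis_affine R m) _; split=> //.
by exists 'X_k => x; rewrite mevalXU.
Qed.

Lemma semireg_conjspace X Y (N : set X) (f : X -> Y) :
  semireg conjc N f -> @semireg R idfun X (conjspace Y) N f.
Proof.
move=> rf U oU; have [o r] := rf U oU; split=> // g rg.
have := r _ rg; rewrite /=.
by under eq_fun do rewrite conjcK.
Qed.

Lemma conjspace_reg X (U : set X) g :
  creg U g -> @creg R (conjspace X) U (fun x => conjc (g x)).
Proof. by move=> rg; rewrite /creg /=; under eq_fun do rewrite conjcK. Qed.

Lemma semireg_of_conjspace X Y (N : set X) (f : X -> Y) :
  semireg idfun N f ->
  @semireg R idfun (conjspace X) (conjspace Y) N f.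
Proof.
move=> rf U oU; have [o r] := rf U oU; split=> // g rg.
exact: (r (fun x => conjc (g x)) rg).
Qed.

End SemiregInstances.

(** * Complex points of a real variety *)

(** The sheaf properties of a real variety whose geometric points lie over a
    closed point in conjugate pairs [y], [tau y]. *)
Record real_ringed (R : realType) (X : rspace R) (tau : rgeo X -> rgeo X) :
    Prop := RealRinged {
  rpr_surj : forall c, exists y, rpr X y = c;
  rprP : forall y z, rpr X y = rpr X z <-> z = y \/ z = tau y;
  ropenI : forall U V : set (rpt X), ropen U -> ropen V -> ropen (U `&` V);
  ropen_cover : forall x, exists U : set (rpt X), ropen U /\ U x;
  rsec_real : forall (U : set (rpt X)) (r : R), ropen U ->
    rsec X U (fun=> real_complex R r);
  rsec_loc : forall (U V : set (rpt X)) f g, rsec X U f -> ropen V ->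
    V `<=` U -> (forall y, V (rpr X y) -> g y = f y) -> rsec X V g;
  rsecD : forall U f g, rsec X U f -> rsec X U g ->
    rsec X U (fun y => f y + g y);
  rsecM : forall U f g, rsec X U f -> rsec X U g ->
    rsec X U (fun y => f y * g y);
  rsec_inv : forall (U : set (rpt X)) f y, ropen U -> rsec X U f ->
    U (rpr X y) -> f y != 0 ->
    exists V g, [/\ ropen V, V (rpr X y), rsec X V g &
      forall z, V (rpr X z) -> f z * g z = 1];
  rsec_conj : forall (U : set (rpt X)) f y, ropen U -> rsec X U f ->
    U (rpr X y) -> f (tau y) = conjc (f y) }.

Lemma cpoint_ext (R : realType) (X : rspace R) (P Q : cpoint X) :
  cp_at P = cp_at Q -> cp_ev P = cp_ev Q -> P = Q.
Proof.
case: P Q => [x f pf] [x' f' pf'] /= xx' ff'; subst x' f'.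
by rewrite (Prop_irrelevance pf pf').
Qed.

Section ComplexAux.
Context (R : realType).
Implicit Types c d : R[i].

(** The next two lemmas give the coefficients of the real polynomial whose roots
    are [c] and its conjugate. *)
Lemma conjc_trace c :
  real_complex R (- (2 * complex.Re c)) = - (c + conjc c).
Proof. by case: c => a b; apply/eqP; rewrite eq_complex /=; apply/andP; split; apply/eqP; ring. Qed.

Lemma conjc_norm c :
  real_complex R (complex.Re c ^+ 2 + complex.Im c ^+ 2) = c * conjc c.
Proof. by case: c => a b; apply/eqP; rewrite eq_complex /=; apply/andP; split; apply/eqP; ring. Qed.

(** 1 and [c] span the complex numbers over the real ones. *)
Lemma real_affine c d : complex.Im c != 0 -> exists a b : R,
  d = real_complex R a * c + real_complex R b /\
  conjc d = real_complex R a * conjc c + real_complex R b.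
Proof.
case: c d => c1 c2 [d1 d2] /= c20; exists (d2 / c2), (d1 - d2 / c2 * c1).
by split; apply/eqP; rewrite eq_complex /=; apply/andP; split; apply/eqP; field.
Qed.

End ComplexAux.

Section CPoints.
Context (R : realType) (X : rspace R) (tau : rgeo X -> rgeo X).
Hypothesis rX : real_ringed tau.

Lemma rpr_tau y : rpr X (tau y) = rpr X y.
Proof. by apply/esym/(rprP rX); right. Qed.

Definition evaluation (y : rgeo X) (f : rgeo X -> R[i]) : R[i] :=
  if `[< germ (rpr X y) f >] then f y else 0.

Lemma evaluationE y f : germ (rpr X y) f -> evaluation y f = f y.
Proof. by rewrite /evaluation => /asboolP ->. Qed.

Lemma germ_real (x : rpt X) r : germ x (fun=> real_complex R r).
Proof.
have [U [oU Ux]] := ropen_cover rX x.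
by exists U; split=> //; apply: (rsec_real rX).
Qed.

Lemma germD (x : rpt X) f g : germ x f -> germ x g -> germ x (fun y => f y + g y).
Proof.
move=> [U [oU Ux rf]] [V [oV Vx rg]]; have oI := ropenI rX oU oV.
exists (U `&` V); split=> //; apply: (rsecD rX).
- by apply: (rsec_loc rX rf) => // ? [].
- by apply: (rsec_loc rX rg) => // ? [].
Qed.

Lemma germM (x : rpt X) f g : germ x f -> germ x g -> germ x (fun y => f y * g y).
Proof.
move=> [U [oU Ux rf]] [V [oV Vx rg]]; have oI := ropenI rX oU oV.
exists (U `&` V); split=> //; apply: (rsecM rX).
- by apply: (rsec_loc rX rf) => // ? [].
- by apply: (rsec_loc rX rg) => // ? [].
Qed.

Lemma evaluation_cpoint y : is_cpoint (rpr X y) (evaluation y).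
Proof.
split.
- move=> U f g oU Uy rf gf.
  have rg : rsec X U g by exact: (rsec_loc rX rf).
  by rewrite !evaluationE ?gf //; [exists U|exists U].
- by move=> f g gf gg; rewrite !evaluationE //; exact: germD.
- by move=> f g gf gg; rewrite !evaluationE //; exact: germM.
- by move=> r; rewrite evaluationE //; exact: germ_real.
- move=> f [U [oU Uy rf]]; rewrite evaluationE; last by exists U.
  move=> fy; have [V [g [oV Vy rg fg]]] := rsec_inv rX oU rf Uy fy.
  by exists g, V; split=> //; exists V.
- by move=> f gf; rewrite /evaluation; case: asboolP.
Qed.

Definition eval_pt (y : rgeo X) : cpoint X := CPoint (evaluation_cpoint y).

Lemma cp_ev_pt (U : set (rpt X)) f y : ropen U -> rsec X U f -> U (rpr X y) ->
  cp_ev (eval_pt y) f = f y.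
Proof. by move=> oU rf Uy; rewrite /= evaluationE //; exists U. Qed.

(** The kernel of a C-point is the maximal ideal of the stalk: a germ that does not
    vanish at [y] is invertible, so the C-point does not kill it; conversely,
    locality makes every germ that it does not kill invertible. *)
Lemma cpoint_germ_eq0 (P : cpoint X) y f : rpr X y = cp_at P -> germ (cp_at P) f ->
  cp_ev P f = 0 <-> f y = 0.
Proof.
case: P => x phi [phiS phiD phiM phiC phiL phi0] /= yx gf; split.
- move=> pf; apply/eqP/negPn/negP => fy.
  have [U [oU Ux rf]] := gf; rewrite -yx in Ux.
  have [V [g [oV Vy rg fg]]] := rsec_inv rX oU rf Ux fy.
  have gg : germ x g by exists V; rewrite -yx.
  have : phi (fun z => f z * g z) = phi (fun=> real_complex R 1).
    by apply: (phiS V) => //; [rewrite -yx|exact: (rsec_real rX)].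
  by rewrite phiM // pf mul0r phiC => /esym/eqP; rewrite fmorph_eq0 oner_eq0.
- move=> fy; apply/eqP/negPn/negP => /(phiL f gf) [g [U [_ oU Ux fg]]].
  have := fg y; rewrite yx => /(_ Ux); rewrite fy mul0r => /esym/eqP.
  by rewrite oner_eq0.
Qed.

(** Every C-point is the evaluation at a geometric point. By the previous lemma a
    C-point factors through the residue field, and the two embeddings of that
    field in C are conjugate. Concretely, if the C-point differs from the
    evaluation at [y] on some germ [f0], it sends [f0] to the conjugate of its
    value, which is not real; any other germ is at [y] a real affine function
    of [f0], so it is conjugated as well. *)
Lemma cpoint_eval (P : cpoint X) : exists y, P = eval_pt y.
Proof.
have [y yx] := rpr_surj rX (cp_at P).
have E := fun f => @cpoint_germ_eq0 P y f yx.
case: (P) (cpointP P) yx E => x phi P0 /= [phiS phiD phiM phiC phiL phi0] yx E.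
have [all|] := pselect (forall f, germ x f -> phi f = f y).
  exists y; apply: cpoint_ext => //=; apply/funext => f.
  by rewrite /evaluation yx; case: asboolP => [/all//|/phi0].
move=> /existsNP[f0 /not_implyP[g0 /eqP ne]].
exists (tau y); apply: cpoint_ext => /=; first by rewrite rpr_tau yx.
apply/funext => f; rewrite /evaluation rpr_tau yx; case: asboolP => [gf|/phi0//].
have [U [oU Ux rf]] := gf; rewrite (rsec_conj rX oU rf) ?yx //.
have gC (r : R) := germ_real x r.
set c := f0 y in ne *.
(* [phi f0] is a root of the real polynomial with roots [c] and [conjc c] *)
have f0c : phi f0 = conjc c.
  have gs : germ x (fun z => real_complex R (- (2 * complex.Re c)) * f0 z +
      real_complex R (complex.Re c ^+ 2 + complex.Im c ^+ 2)).
    exact: germD (germM (gC _) g0) (gC _).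
  have /(E _ (germD (germM g0 g0) gs)) : f0 y * f0 y +
      (real_complex R (- (2 * complex.Re c)) * f0 y +
       real_complex R (complex.Re c ^+ 2 + complex.Im c ^+ 2)) = 0.
    by rewrite -/c conjc_trace conjc_norm; ring.
  rewrite (phiD _ _ (germM g0 g0) gs) (phiD _ _ (germM (gC _) g0) (gC _)).
  rewrite !phiM // !phiC conjc_trace conjc_norm.
  move=> /eqP h; apply/eqP; rewrite -subr_eq0.
  move: h; have -> : forall p : R[i], p * p + (- (c + conjc c) * p + c * conjc c) = (p - c) * (p - conjc c).
    by move=> p; ring.
  by rewrite mulf_eq0 !subr_eq0 (negbTE ne).
have Imc : complex.Im c != 0.
  by apply: contra_neq ne => c0; rewrite f0c; case: (c) c0 => a b /= ->; rewrite oppr0.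
have [a [b [fyE fyJ]]] := real_affine (f y) Imc.
have gl : germ x (fun z => real_complex R (- a) * f0 z + real_complex R (- b)).
  exact: germD (germM (gC _) g0) (gC _).
have /(E _ (germD gf gl)) :
    f y + (real_complex R (- a) * f0 y + real_complex R (- b)) = 0.
  by rewrite -/c fyE !rmorphN; ring.
rewrite (phiD _ _ gf gl) (phiD _ _ (germM (gC _) g0) (gC _)) phiM // !phiC.
rewrite f0c fyJ !rmorphN => h.
by apply/eqP; rewrite -subr_eq0 -h; apply/eqP; ring.
Qed.

Lemma eval_pt_inj y z :
  (z = tau y -> z <> y -> exists f, germ (rpr X y) f /\ f z <> f y) ->
  eval_pt y = eval_pt z -> y = z.
Proof.
move=> sep yz.
have [/esym//|ez] : z = y \/ z = tau y by apply/(rprP rX); exact: (congr1 (@cp_at _ _) yz).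
have [//|/nesym ne] := pselect (y = z).
have [f [gf]] := sep ez ne; case.
have := congr1 (fun P => cp_ev P f) yz.
rewrite /= !evaluationE //.
by rewrite ez rpr_tau.
Qed.

End CPoints.

Section Complexify.
Context (R : realType) (X : rspace R) (tau : rgeo X -> rgeo X).
Hypothesis rX : real_ringed tau.

Definition complexify_basis (D : set (cpoint X)) (F : cpoint X -> R[i]) : Prop :=
  exists (U : set (rpt X)) (f g : rgeo X -> R[i]),
    [/\ ropen U, rsec X U f, rsec X U g, D = [set P | U (cp_at P)] &
        forall P, D P -> F P = cp_ev P f + 'i%C * cp_ev P g].

Lemma ring_basis_complexify : ring_basis complexify_basis.
Proof.
have rR (U : set (rpt X)) r : ropen U -> rsec X U (fun=> real_complex R r).
  exact: (rsec_real rX).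
have rS (U V : set (rpt X)) f : rsec X U f -> ropen V -> V `<=` U -> rsec X V f.
  by move=> rf oV VU; apply: (rsec_loc rX rf).
split.
- move=> P; have [U [oU UP]] := ropen_cover rX (cp_at P).
  exists [set P | U (cp_at P)].
  exists (fun P => cp_ev P (fun=> real_complex R 0) + 'i%C * cp_ev P (fun=> real_complex R 0)).
  split=> //; exists U, (fun=> real_complex R 0), (fun=> real_complex R 0).
  by split=> //; exact: rR.
- move=> D F c [U [f [g [oU rf rg -> _]]]].
  exists U, (fun=> real_complex R (complex.Re c)), (fun=> real_complex R (complex.Im c)).
  split=> //; [exact: rR|exact: rR|move=> P UP].
  rewrite !(cp_const (cpointP P)).
  by case: (c) => a b; apply/eqP; rewrite eq_complex /=; apply/andP; split; apply/eqP; ring.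
- move=> D F D' F' [U [f [g [oU rf rg -> FE]]]] [V [f' [g' [oV rf' rg' -> F'E]]]].
  have oI := ropenI rX oU oV.
  exists (U `&` V), (fun y => f y + f' y), (fun y => g y + g' y); split=> //.
  + by apply: (rsecD rX); [apply: rS rf _ _|apply: rS rf' _ _] => // ? [].
  + by apply: (rsecD rX); [apply: rS rg _ _|apply: rS rg' _ _] => // ? [].
  + move=> P [UP VP]; rewrite FE // F'E //.
    rewrite !(cp_add (cpointP P)); try by [exists U|exists V].
    by ring.
- move=> D F D' F' [U [f [g [oU rf rg -> FE]]]] [V [f' [g' [oV rf' rg' -> F'E]]]].
  have oI := ropenI rX oU oV.
  have rI h : rsec X U h -> rsec X (U `&` V) h by move=> rh; apply: rS rh _ _ => // ? [].
  have rI' h : rsec X V h -> rsec X (U `&` V) h by move=> rh; apply: rS rh _ _ => // ? [].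
  have rM := rsecM rX; have rD := rsecD rX.
  have r1 : rsec X (U `&` V) (fun y => f y * f' y + real_complex R (- 1) * (g y * g' y)).
    by apply: (rD); [apply: (rM); auto|apply: (rM); [exact: rR|apply: (rM); auto]].
  have r2 : rsec X (U `&` V) (fun y => f y * g' y + g y * f' y).
    by apply: (rD); apply: (rM); auto.
  exists (U `&` V), (fun y => f y * f' y + real_complex R (- 1) * (g y * g' y)),
    (fun y => f y * g' y + g y * f' y); split=> //.
  move=> P [UP VP]; rewrite FE // F'E //.
  have [y Py] := cpoint_eval rX P; rewrite Py in UP VP *.
  rewrite (cp_ev_pt rX oU rf) // (cp_ev_pt rX oU rg) // (cp_ev_pt rX oV rf') // (cp_ev_pt rX oV rg') //.
  rewrite (cp_ev_pt rX oI r1) // (cp_ev_pt rX oI r2) // rmorphN rmorph1.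
  have i2 : 'i%C * 'i%C = - 1 :> R[i] by rewrite -expr2 sqr_i.
  transitivity (f y * f' y + ('i%C * 'i%C) * (g y * g' y) + 'i%C * (f y * g' y + g y * f' y)); first by ring.
  by rewrite i2.
Qed.

Lemma ringed_complexify : ringed (complexify X).
Proof. exact/ringed_ratspace/ring_basis_complexify. Qed.

Lemma complexify_reg (U : set (rpt X)) f g : ropen U -> rsec X U f -> rsec X U g ->
  @creg R (complexify X) [set P | U (cp_at P)] (fun P => cp_ev P f + 'i%C * cp_ev P g).
Proof.
move=> oU rf rg; apply: ratspace_reg; first exact: ring_basis_complexify.
by exists U, f, g.
Qed.

End Complexify.

Section RealQuotient.
Context (R : realType) (Y : cspace R) (s : real_structure Y).

Definition orbit2 (y : Y) : set Y := [set y' | y' = y \/ y' = s y].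

Lemma cls_orbit2 y z : cls orbit2 y = cls orbit2 z <-> z = y \/ z = s y.
Proof.
split.
  move=> /(congr1 val) /= e; have : orbit2 y z by rewrite e; left.
  by [].
move=> yz; apply: val_inj; apply/seteqP; split=> x /=; rewrite /orbit2 /=.
  by case: yz => ->; case=> ->; rewrite ?rsK; [left|right|right|left].
by case: yz => ->; rewrite ?rsK; case; auto.
Qed.

Lemma real_ringed_quot : ringed Y -> @real_ringed R (realquot s) s.
Proof.
move=> rY; split.
- by move=> c; exists (qrepr c); exact: (@qreprK Y orbit2).
- exact: cls_orbit2.
- by move=> U V; exact: (openI rY).
- by move=> x; exists setT; split=> //; exact: (openT rY).
- move=> U r oU; split; first exact: (reg_cst rY).
  by move=> y _; rewrite conjc_real.
- move=> U V f g [rf sf] oV VU fg; split.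
    apply: (reg_eq rY) (reg_sub rY oV rf _) fg.
    by move=> y; exact: VU.
  move=> y Vy; have Vsy : V (cls orbit2 (s y)).
    by rewrite (_ : cls _ _ = cls orbit2 y) //; apply/esym/cls_orbit2; right.
  by rewrite !fg // sf //; exact: VU.
- move=> U f g [rf sf] [rg sg]; split; first exact: (regD rY).
  by move=> y Uy; rewrite sf // sg // rmorphD.
- move=> U f g [rf sf] [rg sg]; split; first exact: (regM rY).
  by move=> y Uy; rewrite sf // sg // rmorphM.
- move=> U f y oU [rf sf] Uy fy.
  pose V : set (quot orbit2) := [set c | U c /\ exists2 z, cls orbit2 z = c & f z != 0].
  have VE : [set z | V (cls orbit2 z)] = [set z | U (cls orbit2 z)] `&` [set z | f z != 0].
    apply/seteqP; split=> z /= [Uz]; last by split=> //; exists z.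
    case=> z' zz' fz'; split=> //; rewrite -zz' in Uz.
    by move/cls_orbit2: zz' => [->//|->]; rewrite /= sf // conjc_eq0.
  have rV := regV rY rf; rewrite -VE in rV.
  have oV := reg_open rY rV.
  exists V, (fun z => (f z)^-1); split=> //.
  + by split=> //; exists y.
  + split=> // z [Uz _]; rewrite sf //.
    exact/esym/conjc_inv.
  + move=> z Vz; have [_ /= fz] : ([set z | U (cls orbit2 z)] `&` [set z | f z != 0]) z by rewrite -VE.
    by rewrite divff.
- by move=> U f y oU [_ sf] Uy; exact: sf.
Qed.

End RealQuotient.

Section RealOpen.
Context (R : realType) (X : rspace R) (tau : rgeo X -> rgeo X).
Context (A : set (rpt X)).
Hypotheses (rX : real_ringed tau) (oA : ropen A).

Lemma open_tau (y : rgeo (ropensub A)) : (rpr X @^-1` A) (tau (val y)).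
Proof. by rewrite /preimage /= (rpr_tau rX); exact: (set_mem (valP y)). Qed.

Definition tau_open (y : rgeo (ropensub A)) : rgeo (ropensub A) :=
  SigSub (mem_set (open_tau y)).

Lemma image_val_set (U : set A) x : [set val x | x in U] (val x) <-> U x.
Proof. by split=> [[x' Ux' /val_inj <-]|Ux]; [|exists x]. Qed.

Lemma real_ringed_open : real_ringed tau_open.
Proof.
have liftA (U : set (rpt X)) : U `<=` A -> [set val x | x in [set x : A | U (val x)]] = U.
  move=> UA; apply/seteqP; split=> [_ [x Ux <-]|x Ux] //.
  by exists (SigSub (mem_set (UA _ Ux))).
split.
- move=> c; have [y yc] := rpr_surj rX (val c).
  have Ay : (rpr X @^-1` A) y by rewrite /preimage /= yc; exact: (set_mem (valP c)).
  by exists (SigSub (mem_set Ay)); exact: val_inj.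
- move=> y z; split.
    move=> /(congr1 val) /= /(rprP rX) [e|e]; [left|right]; exact: val_inj.
  move=> e; apply: val_inj => /=; apply/(rprP rX).
  by case: e => ->; [left|right].
- move=> U V oU oV; rewrite /ropen /=.
  have -> : [set val x | x in U `&` V] = [set val x | x in U] `&` [set val x | x in V].
    apply/seteqP; split=> [_ [x [Ux Vx] <-]|_ [[x Ux <-] /image_val_set Vx]].
      by split; exists x.
    by exists x.
  exact: (ropenI rX).
- move=> x; exists setT; split=> //; rewrite /ropen /=.
  rewrite (_ : [set val x | x in _] = A) //.
  apply/seteqP; split=> [_ [x' _ <-]|x' Ax']; first exact: (set_mem (valP x')).
  by exists (SigSub (mem_set Ax')).
- move=> U r oU; exists (fun=> real_complex R r); split=> //.
  exact: (rsec_real rX).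
- move=> U V f g [f' [rf' ff']] oV VU fg; exists f'; split.
    apply: (rsec_loc rX) rf' _ _ _ => // x [x' Vx' <-].
    by exists x' => //; exact: VU.
  move=> y Vy; rewrite fg ?ff' //; last by apply/image_val_set.
  by case: Vy => x' Vx' <-; exists x' => //; exact: VU.
- move=> U f g [f' [rf' ff']] [g' [rg' gg']]; exists (fun y => f' y + g' y).
  by split; [exact: (rsecD rX)|move=> y Uy; rewrite ff' // gg'].
- move=> U f g [f' [rf' ff']] [g' [rg' gg']]; exists (fun y => f' y * g' y).
  by split; [exact: (rsecM rX)|move=> y Uy; rewrite ff' // gg'].
- move=> U f y oU [f' [rf' ff']] Uy fy.
  have Uy' : [set val x | x in U] (rpr X (val y)).
    by exists (rpr (ropensub A) y).
  rewrite ff' // in fy.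
  have [V [g [oV Vy rg fg]]] := rsec_inv rX oU rf' Uy' fy.
  have oI : ropen (V `&` [set val x | x in U]) by exact: (ropenI rX).
  have IE : [set val x | x in [set x : A | (V `&` [set val x | x in U]) (val x)]] =
      V `&` [set val x | x in U].
    by apply: liftA => x [_ [x' _ <-]]; exact: (set_mem (valP x')).
  exists [set x : A | (V `&` [set val x | x in U]) (val x)], (fun y => g (val y)).
  split.
  + by rewrite /ropen /= IE.
  + by split.
  + exists g; split=> //; rewrite IE.
    by apply: (rsec_loc rX) rg _ _ _ => // ? [].
  + by move=> z [Vz Uz]; rewrite ff' // fg.
- move=> U f y oU [f' [rf' ff']] Uy.
  have Uy' : [set val x | x in U] (rpr X (val y)).
    by exists (rpr (ropensub A) y).
  rewrite !ff' //=; first exact: (rsec_conj rX oU).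
  by rewrite (rpr_tau rX).
Qed.

End RealOpen.

(** * Projective spaces and the line bundles O(n) on the projective line *)

Section Projective.
Context (R : realType).
Local Notation C := R[i].

Lemma ones_neq0 m : const_mx 1 != 0 :> 'rV[C]_m.+1.
Proof. by apply/rV0Pn; exists 0; rewrite mxE oner_neq0. Qed.

Definition tocone m (v : 'rV[C]_m.+1) : cone R m.+1 :=
  match pselect (v != 0) with
  | left v0 => mkcone v0
  | right _ => mkcone (ones_neq0 m)
  end.

Lemma cvec_tocone m (v : 'rV[C]_m.+1) : v != 0 -> cvec (tocone v) = v.
Proof. by rewrite /tocone; case: pselect. Qed.

Lemma cvec_inj m : injective (@cvec R m).
Proof. exact: val_inj. Qed.

Lemma toconeK m (x : cone R m.+1) : tocone (cvec x) = x.
Proof. by apply: cvec_inj; rewrite cvec_tocone // cvec_neq0. Qed.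

Lemma ringed_cone m : ringed (cone R m).
Proof. exact/ringed_subspace/ringed_affine. Qed.

Lemma ringed_projspace m : ringed (projspace R m).
Proof. exact/ringed_quotspace/ringed_cone. Qed.

Lemma cvec_reg m k : @creg R (cone R m) setT (fun x => cvec x 0 k).
Proof.
have rA := ringed_affine R m.
have rv : @semireg R idfun (cone R m) (affine R m) setT (fun x => val x).
  exact: semireg_val.
by apply: (semireg_reg rv (openT rA) (affine_coord_reg R k)).
Qed.

Lemma semireg_tocone (c : {rmorphism C -> C}) (X : cspace R) m (N : set X)
    (f : X -> 'rV[C]_m.+1) : ringed X -> copen N ->
  (forall k, creg N (fun x => c (f x 0 k))) -> (forall x, N x -> f x != 0) ->
  semireg c N (fun x => tocone (f x)).
Proof.
move=> rX oN rf f0; apply: semireg_subspace => //.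
apply: semireg_affine => // k; apply: (reg_eq rX (rf k)) => x Nx.
by rewrite -[in RHS](cvec_tocone (f0 x Nx)).
Qed.

Definition pt m (v : 'rV[C]_m.+1) : projspace R m := pcls (tocone v).

Lemma pt_cvec m (x : cone R m.+1) : pt (cvec x) = pcls x.
Proof. by rewrite /pt toconeK. Qed.

Lemma ptP m (p : projspace R m) : exists v, v != 0 /\ p = pt v.
Proof. by have [x ->] := pclsP p; exists (cvec x); rewrite cvec_neq0 pt_cvec. Qed.

Lemma ptZ m t (v : 'rV[C]_m.+1) : t != 0 -> v != 0 -> pt (t *: v) = pt v.
Proof.
by move=> t0 v0; apply: (pcls_eq t0); rewrite !cvec_tocone // scaler_eq0 negb_or t0.
Qed.

Lemma pcls_inj m (x y : cone R m.+1) : pcls x = pcls y ->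
  exists t, t != 0 /\ cvec y = t *: cvec x.
Proof.
move=> /(congr1 val) /= e; have : scaling y y by exists 1; rewrite oner_neq0 scale1r.
by rewrite -e.
Qed.

Lemma pt_inj m (v w : 'rV[C]_m.+1) : v != 0 -> w != 0 -> pt v = pt w ->
  exists t, t != 0 /\ w = t *: v.
Proof. by move=> v0 w0 /pcls_inj; rewrite !cvec_tocone. Qed.

Lemma semireg_pt (c : {rmorphism C -> C}) (X : cspace R) m (N : set X)
    (f : X -> 'rV[C]_m.+1) : ringed X -> copen N ->
  (forall k, creg N (fun x => c (f x 0 k))) -> (forall x, N x -> f x != 0) ->
  semireg c N (fun x => pt (f x)).
Proof. by move=> rX oN rf f0; apply: semireg_quotspace; exact: semireg_tocone. Qed.

Definition chart m (i : 'I_m.+1) : set (projspace R m) :=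
  [set p | cvec (qrepr p) 0 i != 0].

Definition hcoord m (i : 'I_m.+1) (p : projspace R m) : 'rV[C]_m.+1 :=
  (cvec (qrepr p) 0 i)^-1 *: cvec (qrepr p).

Lemma chart_pcls m i (x : cone R m.+1) : chart i (pcls x) <-> cvec x 0 i != 0.
Proof.
have [t [t0 e]] := qrepr_pcls x.
by rewrite /chart /= e mxE mulf_eq0 negb_or t0.
Qed.

Lemma hcoord_pcls m i (x : cone R m.+1) :
  hcoord i (pcls x) = (cvec x 0 i)^-1 *: cvec x.
Proof.
have [t [t0 e]] := qrepr_pcls x.
by rewrite /hcoord e mxE scalerA invfM mulrAC mulVf // mul1r.
Qed.

Lemma chart_pt m i (v : 'rV[C]_m.+1) : v != 0 -> chart i (pt v) <-> v 0 i != 0.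
Proof. by move=> v0; rewrite chart_pcls cvec_tocone. Qed.

Lemma hcoord_pt m i (v : 'rV[C]_m.+1) : v != 0 ->
  hcoord i (pt v) = (v 0 i)^-1 *: v.
Proof. by move=> v0; rewrite hcoord_pcls cvec_tocone. Qed.

Lemma chart_cover m (p : projspace R m) : exists i, chart i p.
Proof. by have /rV0Pn[i xi] := cvec_neq0 (qrepr p); exists i. Qed.

Lemma hcoord_reg m i k : creg (@chart m i) (fun p => hcoord i p 0 k).
Proof.
have rC := ringed_cone m.+1.
have rV := regM rC (regV rC (cvec_reg i))
  (reg_sub rC (open_neq0 rC (cvec_reg i)) (cvec_reg k) (@subsetT _ _)).
change (@creg R (cone R m.+1) [set x | chart i (cls (@scaling R m.+1) x)]
  (fun x => hcoord i (cls (@scaling R m.+1) x) 0 k)).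
have -> : [set x | chart i (cls (@scaling R m.+1) x)] =
   setT `&` [set x : cone R m.+1 | cvec x 0 i != 0].
  by rewrite setTI; apply/seteqP; split=> x /chart_pcls.
apply: (reg_eq rC rV) => x _.
by have := hcoord_pcls i x; rewrite /pcls => ->; rewrite mxE.
Qed.

Lemma chart_open m i : copen (@chart m i).
Proof. exact: (reg_open (ringed_projspace m) (hcoord_reg i i)). Qed.

Lemma hcoord_neq0 m i (p : projspace R m) : chart i p -> hcoord i p != 0.
Proof.
by move=> pi; rewrite scaler_eq0 negb_or invr_eq0 cvec_neq0 andbT.
Qed.

Lemma pt_hcoord m i (p : projspace R m) : chart i p -> pt (hcoord i p) = p.
Proof.
have [v [v0 ->]] := ptP p; rewrite (chart_pt _ v0) (hcoord_pt _ v0) => vi.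
by rewrite ptZ // invr_neq0.
Qed.

Section LineBundle.
Variable n : nat.

Definition opt (x : 'rV[C]_2) (v : C) : quotspace (@Oequiv R n) :=
  Ocls n (tocone x) (const_mx v).

Lemma rV1_const (v : 'rV[C]_1) : v = const_mx (v 0 0).
Proof. by apply/rowP => k; rewrite mxE ord1. Qed.

Lemma Oequiv_refl z : @Oequiv R n z z.
Proof. by exists 1; rewrite oner_neq0 expr1n !scale1r. Qed.

Lemma optZ t x v : t != 0 -> x != 0 -> opt (t *: x) (t ^+ n * v) = opt x v.
Proof.
move=> t0 x0; have tx0 : t *: x != 0 by rewrite scaler_eq0 negb_or t0.
apply: val_inj; apply/seteqP; split=> z [u [u0]] /=; rewrite !cvec_tocone // => e1 e2.
  exists (u * t); rewrite mulf_neq0 // e1 e2 /= cvec_tocone // scalerA exprMn.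
  by split=> //; apply/rowP => k; rewrite !mxE mulrA.
exists (u / t); rewrite mulf_neq0 ?invr_neq0 // e1 e2 /= cvec_tocone //.
split=> //; first by rewrite scalerA mulfVK.
apply/rowP => k; rewrite !mxE expr_div_n mulrA.
by rewrite -[_ / _ * _ in RHS]mulrA mulVf ?mulr1 // expf_neq0.
Qed.

Lemma opt_inj x v y w : x != 0 -> y != 0 -> opt x v = opt y w ->
  exists t, [/\ t != 0, y = t *: x & w = t ^+ n * v].
Proof.
move=> x0 y0 /(congr1 val) /= e.
have : Oequiv n (tocone y, const_mx w) (tocone y, const_mx w).
  exact: Oequiv_refl.
rewrite -e => -[t [t0]] /=; rewrite !cvec_tocone // => yx /rowP/(_ 0).
by rewrite !mxE => wv; exists t.
Qed.

Lemma fib_Obundle p e : fib (Obundle R n) p e <->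
  exists x v, [/\ x != 0, p = pt x & e = opt x v].
Proof.
split=> [[x [v [-> ->]]]|[x [v [x0 -> ->]]]].
  exists (cvec x), (v 0 0); rewrite cvec_neq0 /opt pt_cvec toconeK.
  by rewrite -(rV1_const v).
by exists (tocone x), (const_mx v).
Qed.

Lemma lincomb_Obundle a e1 e2 e3 : lincomb (Obundle R n) a e1 e2 e3 <->
  exists x v w, [/\ x != 0, e1 = opt x v, e2 = opt x w & e3 = opt x (a * v + w)].
Proof.
split=> [[x [v [w [-> -> ->]]]]|[x [v [w [x0 -> -> ->]]]]].
  exists (cvec x), (v 0 0), (w 0 0).
  rewrite cvec_neq0 /opt toconeK -(rV1_const v) -(rV1_const w); split=> //.
  by congr Ocls; apply/rowP => k; rewrite !mxE ord1.
exists (tocone x), (const_mx v), (const_mx w); split=> //.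
by congr Ocls; apply/rowP => k; rewrite !mxE.
Qed.

Lemma semireg_opt (c : {rmorphism C -> C}) (X : cspace R) (N : set X)
    (f : X -> 'rV[C]_2) (g : X -> C) : ringed X -> copen N ->
  (forall k, creg N (fun x => c (f x 0 k))) -> (forall x, N x -> f x != 0) ->
  creg N (fun x => c (g x)) ->
  semireg c N (fun x => opt (f x) (g x)).
Proof.
move=> rX oN rf f0 rg.
apply: (@semireg_quotspace R c X (prodspace (cone R 2) (affine R 1))
  (@Oequiv R n) N (fun x => (tocone (f x), const_mx (g x)))).
apply: semireg_prodspace => //=; first exact: semireg_tocone.
apply: semireg_affine => // k.
by under eq_fun do rewrite mxE.
Qed.

Lemma qrepr_opt x v : x != 0 -> exists t : C, [/\ t != 0,
  cvec (qrepr (opt x v)).1 = t *: x & (qrepr (opt x v)).2 0 0 = t ^+ n * v].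
Proof.
move=> x0; have := @qreprK _ (@Oequiv R n) (opt x v).
case: (qrepr (opt x v)) => y w /= e.
have {}e : opt (cvec y) (w 0 0) = opt x v.
  by rewrite -e /opt toconeK -(rV1_const w).
by have [t [t0 ? ?]] := opt_inj x0 (cvec_neq0 y) (esym e); exists t.
Qed.

(** The fibre coordinate of O(n) in the trivialization by the [n]-th power of
    the [i]-th homogeneous coordinate. *)
Definition ocoord (i : 'I_2) (e : quotspace (@Oequiv R n)) : C :=
  (qrepr e).2 0 0 / cvec (qrepr e).1 0 i ^+ n.

Definition ochart (i : 'I_2) : set (quotspace (@Oequiv R n)) :=
  [set e | cvec (qrepr e).1 0 i != 0].

Lemma ocoord_opt i x v : x != 0 -> ocoord i (opt x v) = v / x 0 i ^+ n.
Proof.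
move=> x0; have [t [t0 e1 e2]] := qrepr_opt v x0.
by rewrite /ocoord e1 e2 mxE exprMn -mulf_div divff ?mul1r // expf_neq0.
Qed.

Lemma ochart_opt i x v : x != 0 -> ochart i (opt x v) <-> x 0 i != 0.
Proof.
move=> x0; have [t [t0 e1 _]] := qrepr_opt v x0.
by rewrite /ochart /= e1 mxE mulf_eq0 negb_or t0.
Qed.

Lemma ringed_Otot : ringed (quotspace (@Oequiv R n)).
Proof.
apply/ringed_quotspace/ringed_prodspace; [exact: ringed_cone|exact: ringed_affine].
Qed.

Lemma ocoord_reg i : creg (ochart i) (ocoord i).
Proof.
have rC := ringed_cone 2; have rA := ringed_affine R 1.
have rP := ringed_prodspace rC rA.
have r1 : @creg R (prodspace (cone R 2) (affine R 1)) setT (fun z => cvec z.1 0 i).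
  by apply: (semireg_reg (semireg_fst rC rA) (openT rC) (cvec_reg i)).
have r2 : @creg R (prodspace (cone R 2) (affine R 1)) setT (fun z => (z.2 : 'rV_1) 0 0).
  by apply: (semireg_reg (semireg_snd rC rA) (openT rA) (affine_coord_reg R 0)).
have rV := regM rP (reg_sub rP (open_neq0 rP r1) r2 (@subsetT _ _))
   (regX rP n (regV rP r1)).
have E x v : cls (@Oequiv R n) (x, v) = opt (cvec x) (v 0 0).
  by rewrite /opt toconeK -rV1_const.
change (@creg R (prodspace (cone R 2) (affine R 1))
  [set z | ochart i (cls (@Oequiv R n) z)] (fun z => ocoord i (cls (@Oequiv R n) z))).
have -> : [set z | ochart i (cls (@Oequiv R n) z)] =
   setT `&` [set z : prodspace (cone R 2) (affine R 1) | cvec z.1 0 i != 0].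
  by rewrite setTI; apply/seteqP; split=> -[x v]; rewrite /= E (ochart_opt _ _ (cvec_neq0 x)).
apply: (reg_eq rP rV) => -[x v] _ /=.
by rewrite E ocoord_opt ?cvec_neq0 // exprVn.
Qed.

Lemma ochart_open i : copen (ochart i).
Proof. exact: (reg_open ringed_Otot (ocoord_reg i)). Qed.

End LineBundle.
End Projective.

(** * The affine quadric *)

Section Quadric.
Context (R : realType).
Local Notation C := R[i].

Lemma I2P (k : 'I_2) : k = 0 \/ k = 1.
Proof. by case: k => [[|[|//]]] lt_k; [left|right]; exact: val_inj. Qed.

Lemma I4P (P : 'I_4 -> Prop) : P (inord 0) -> P (inord 1) -> P (inord 2) ->
  P (inord 3) -> forall k, P k.
Proof.
move=> p0 p1 p2 p3 k; rewrite -(inord_val k).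
by case: k => [[|[|[|[|//]]]]] lt_k.
Qed.

Lemma i2N1 : 'i%C * 'i%C = - 1 :> C.
Proof. by rewrite -expr2 sqr_i. Qed.

Lemma two_neq0 : 2 != 0 :> C.
Proof. by rewrite Num.Theory.pnatr_eq0. Qed.

Definition dot (x y : 'rV[C]_2) : C := x 0 0 * y 0 0 + x 0 1 * y 0 1.

Local Notation T := (inord 3 : 'I_4).

Lemma psivec_T (x y : 'rV[C]_2) : psivec x y 0 T = dot x y.
Proof. by rewrite mxE inordK. Qed.

(** The inverse of [psivec] on the level of 2 x 2 matrices: when
    w = psivec x y, these are the products x_i y_j. *)
Definition seg (w : 'rV[C]_4) (i j : 'I_2) : C :=
  (if i == 0 then if j == 0 then w 0 T + w 0 (inord 2)
                  else w 0 (inord 0) + 'i%C * w 0 (inord 1)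
   else if j == 0 then w 0 (inord 0) - 'i%C * w 0 (inord 1)
        else w 0 T - w 0 (inord 2)) / 2.

Lemma seg_psivec x y i j : seg (psivec x y) i j = x 0 i * y 0 j.
Proof.
have t0 := two_neq0.
rewrite /seg !mxE !inordK //= !mulrA i2N1.
by case: (I2P i) => ->; case: (I2P j) => -> /=; field.
Qed.

Lemma seg_inj w w' : (forall i j, seg w i j = seg w' i j) -> w = w'.
Proof.
have t0 := two_neq0.
move=> e; have := (e 0 0, e 0 1, e 1 0, e 1 1); rewrite /seg /=.
have h (a b : C) : a / 2 = b / 2 -> a = b by move/(mulIf (invr_neq0 t0)).
move=> [[[/h e0 /h e1] /h e2] /h e3].
have i0 : 'i%C != 0 :> C by rewrite -sqrf_eq0 expr2 i2N1 oppr_eq0 oner_eq0.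
have h2 (a b a' b' : C) : a + b = a' + b' -> a - b = a' - b' -> a = a' /\ b = b'.
  move=> p m; split; apply: (mulIf t0).
    by transitivity ((a + b) + (a - b)); [ring|rewrite p m; ring].
  by transitivity ((a + b) - (a - b)); [ring|rewrite p m; ring].
have [eT eZ] := h2 _ _ _ _ e0 e3; have [eX /(mulfI i0) eY] := h2 _ _ _ _ e1 e2.
by apply/rowP; exact: I4P.
Qed.

(** The quadratic form is, up to sign, four times the determinant, hence the
    points of the quadric are the matrices of rank one. *)
Lemma qform_seg w : qform w = 0 -> forall i j k l,
  seg w i j * seg w k l = seg w i l * seg w k j.
Proof.
rewrite /qform => q0.
suff h : seg w 0 0 * seg w 1 1 = seg w 0 1 * seg w 1 0.
  move=> i j k l.
  by case: (I2P i) => ->; case: (I2P j) => ->; case: (I2P k) => ->; case: (I2P l) => ->;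
    first [by [] | exact: mulrC | by rewrite h | by rewrite -h |
           by rewrite mulrC h mulrC | by rewrite mulrC -h mulrC].
have t0 := two_neq0.
rewrite /seg /=; apply/eqP; rewrite -subr_eq0; apply/eqP.
set X := w 0 (inord 0) in q0 *; set Y := w 0 (inord 1) in q0 *.
set Z := w 0 (inord 2) in q0 *; set W := w 0 T in q0 *.
transitivity (- (X ^+ 2 - 'i%C * 'i%C * Y ^+ 2 + Z ^+ 2 - W ^+ 2) / 2 ^+ 2); first by field.
by rewrite i2N1 mulN1r opprK q0 oppr0 mul0r.
Qed.

Lemma seg_trace w : seg w 0 0 + seg w 1 1 = w 0 T.
Proof. by have t0 := two_neq0; rewrite /seg /=; field. Qed.

(** A rank one matrix is the product of its [i]-th column by its [i]-th row
    divided by their common entry. One of the two diagonal entries is nonzero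
    where T <> 0, since T is the trace. *)
Definition liftx (i : 'I_2) (w : 'rV[C]_4) : 'rV[C]_2 := \row_k seg w k i.
Definition lifty (i : 'I_2) (w : 'rV[C]_4) : 'rV[C]_2 :=
  \row_k (seg w i k / seg w i i).

Lemma psivec_lift i w : qform w = 0 -> seg w i i != 0 ->
  psivec (liftx i w) (lifty i w) = w.
Proof.
move=> q0 wi; apply: seg_inj => k l; rewrite seg_psivec !mxE mulrA.
by rewrite (qform_seg q0) mulfK.
Qed.

Lemma psivec_nz (x y : 'rV[C]_2) : x != 0 -> y != 0 -> psivec x y != 0.
Proof.
by move=> x0 y0; have := psivec_neq0 (tocone x) (tocone y); rewrite !cvec_tocone.
Qed.

Lemma psi_pt (x y : 'rV[C]_2) : x != 0 -> y != 0 ->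
  val (psi (pt x, pt y)) = pt (psivec x y).
Proof.
move=> x0 y0; rewrite psi_cls -pt_cvec.
by congr pt; rewrite /cvec /= -/(cvec _) -/(cvec _) !cvec_tocone.
Qed.

(** The affine sphere, with homogeneous coordinates normalized by T = 1. *)
Definition sph : set (quadricC R) := [set w | chart T (val w)].
Definition scoord (w : quadricC R) : 'rV[C]_4 := hcoord T (val w).

Lemma dot_neq0 (x y : 'rV[C]_2) : dot x y = 1 -> x != 0 /\ y != 0.
Proof.
move=> d1; split; apply: contra_eq_neq d1 => ->;
  by rewrite /dot !mxE ?mul0r ?mulr0 addr0 eq_sym oner_neq0.
Qed.

Lemma sph_psi (x y : 'rV[C]_2) : x != 0 -> y != 0 ->
  sph (psi (pt x, pt y)) <-> dot x y != 0.
Proof.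
by move=> x0 y0; rewrite /sph /mkset psi_pt // (chart_pt _ (psivec_nz x0 y0)) psivec_T.
Qed.

Lemma scoord_psi (x y : 'rV[C]_2) : dot x y = 1 ->
  scoord (psi (pt x, pt y)) = psivec x y.
Proof.
move=> d1; have [x0 y0] := dot_neq0 d1.
by rewrite /scoord psi_pt // (hcoord_pt _ (psivec_nz x0 y0)) psivec_T d1 invr1 scale1r.
Qed.

Lemma scoord_inj w w' : sph w -> sph w' -> scoord w = scoord w' -> w = w'.
Proof.
move=> sw sw' e; apply: val_inj.
by rewrite -(pt_hcoord sw) -(pt_hcoord sw') -/(scoord _) e.
Qed.

Lemma scoord_T w : sph w -> scoord w 0 T = 1.
Proof. by move=> sw; rewrite mxE mulVf. Qed.

Lemma qformZ t (w : 'rV[C]_4) : qform (t *: w) = t ^+ 2 * qform w.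
Proof. by rewrite /qform !mxE; ring. Qed.

Lemma scoord_qform w : qform (scoord w) = 0.
Proof.
have [x [e q0]] := set_mem (valP w).
by rewrite /scoord e hcoord_pcls qformZ q0 mulr0.
Qed.

Lemma sph_lift w : sph w -> exists i, seg (scoord w) i i != 0.
Proof.
move=> sw; have [e|] := eqVneq (seg (scoord w) 0 0) 0; last by exists 0.
exists 1; apply: contra_eq_neq (scoord_T sw) => e1.
by rewrite -seg_trace e e1 addr0 eq_sym oner_neq0.
Qed.

Lemma sph_rep w : sph w -> exists x y,
  dot x y = 1 /\ w = psi (pt x, pt y).
Proof.
move=> sw; have [i wi] := sph_lift sw.
have e := psivec_lift (scoord_qform w) wi.
exists (liftx i (scoord w)), (lifty i (scoord w)).
have d1 : dot (liftx i (scoord w)) (lifty i (scoord w)) = 1.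
  by rewrite -psivec_T e scoord_T.
split=> //; apply: (scoord_inj sw); last by rewrite (scoord_psi d1) e.
by have [x0 y0] := dot_neq0 d1; apply/(sph_psi x0 y0); rewrite d1 oner_neq0.
Qed.

(** The scalars relating two factorizations of a matrix of trace 1 are the
    pairings dot x' y and dot x y'. *)
Lemma psivec_eq x y x' y' : dot x y = 1 -> dot x' y' = 1 ->
  psivec x y = psivec x' y' ->
  exists t s, [/\ t * s = 1, x' = t *: x & y' = s *: y].
Proof.
move=> d1 d1' e.
have eq i j : x 0 i * y 0 j = x' 0 i * y' 0 j by rewrite -!seg_psivec e.
have x'E : x' = dot x' y *: x.
  apply/rowP => i; rewrite mxE; transitivity (dot x' y' * x' 0 i); first by rewrite d1' mul1r.
  transitivity (x' 0 0 * (x' 0 i * y' 0 0) + x' 0 1 * (x' 0 i * y' 0 1)); first by rewrite /dot; ring.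
  by rewrite -!eq /dot; ring.
have xE : x = dot x y' *: x'.
  apply/rowP => i; rewrite mxE; transitivity (dot x y * x 0 i); first by rewrite d1 mul1r.
  transitivity (x 0 0 * (x 0 i * y 0 0) + x 0 1 * (x 0 i * y 0 1)); first by rewrite /dot; ring.
  by rewrite !eq /dot; ring.
have yE : y' = dot x y' *: y.
  apply/rowP => i; rewrite mxE; transitivity (dot x' y' * y' 0 i); first by rewrite d1' mul1r.
  transitivity (y' 0 0 * (x' 0 0 * y' 0 i) + y' 0 1 * (x' 0 1 * y' 0 i)); first by rewrite /dot; ring.
  by rewrite -!eq /dot; ring.
exists (dot x' y), (dot x y'); split=> //.
have [x0 _] := dot_neq0 d1; have /rV0Pn[i xi] := x0.
apply: (mulIf xi); rewrite mul1r.
by rewrite -mulrA mulrCA [in RHS]xE [in RHS]x'E !mxE; ring.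
Qed.

Lemma psi_inj_sph x y q : dot x y = 1 -> psi q = psi (pt x, pt y) ->
  q = (pt x, pt y).
Proof.
move=> d1; have [x0 y0] := dot_neq0 d1.
case: q => p q; have [x' [x'0 ->]] := ptP p; have [y' [y'0 ->]] := ptP q => e.
have d0 : dot x' y' != 0.
  by apply/(sph_psi x'0 y'0); rewrite e; apply/(sph_psi x0 y0); rewrite d1 oner_neq0.
pose y1 := (dot x' y')^-1 *: y'.
have y1E : pt y1 = pt y' by exact: (ptZ (invr_neq0 d0) y'0).
have d1' : dot x' y1 = 1.
  by rewrite /dot !mxE !mulrA ![_ * (dot _ _)^-1]mulrC -!mulrA -mulrDr -/(dot _ _) mulVf.
rewrite -y1E in e *.
have := congr1 (fun w => scoord w) e; rewrite (scoord_psi d1) (scoord_psi d1').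
move=> /esym/(psivec_eq d1 d1').
move=> [t [s [ts -> ->]]].
have t0 : t != 0 by apply: contra_eq_neq ts => ->; rewrite mul0r eq_sym oner_neq0.
have s0 : s != 0 by apply: contra_eq_neq ts => ->; rewrite mulr0 eq_sym oner_neq0.
by rewrite !ptZ.
Qed.

Local Notation conjv := (map_mx (@conjc R)).

Lemma conjv_eq0 m (x : 'rV[C]_m) : (conjv x == 0) = (x == 0).
Proof. by rewrite map_mx_eq0. Qed.

Lemma pconj_pt m (x : 'rV[C]_m.+1) : x != 0 -> pconj (pt x) = pt (conjv x).
Proof.
move=> x0; rewrite /pt pconj_cls; apply: (@pcls_eq _ _ _ _ 1); rewrite ?oner_neq0 //.
by rewrite /cvec /= -/(cvec _) -/(cvec _) !cvec_tocone ?conjv_eq0 // scale1r.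
Qed.

Lemma seg_conj w i j : seg (conjv w) i j = conjc (seg w j i).
Proof.
rewrite /seg !mxE rmorphM fmorphV rmorph_nat; congr (_ * _).
have cI : conjc 'i%C = - 'i%C :> C.
  by apply/eqP; rewrite eq_complex /= oppr0 !eqxx.
have cD (a b : C) : conjc (a + b) = conjc a + conjc b by rewrite rmorphD.
have cB (a b : C) : conjc (a - b) = conjc a - conjc b by rewrite rmorphB.
have cM (a : C) : conjc ('i%C * a) = - ('i%C * conjc a) by rewrite rmorphM [X in X * _]cI mulNr.
case: (I2P i) => ->; case: (I2P j) => ->; rewrite /= ?cB ?cD //.
  by rewrite cM opprK.
by rewrite cM.
Qed.

Lemma psivec_conj x y : psivec (conjv y) (conjv x) = conjv (psivec x y).
Proof.
by apply: seg_inj => i j; rewrite seg_conj !seg_psivec rmorphM !mxE mulrC.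
Qed.

Lemma val_qconj (w : quadricC R) : val (qconj R w) = pconj (val w).
Proof. by []. Qed.

Lemma qconj_psi x y : x != 0 -> y != 0 ->
  qconj R (psi (pt x, pt y)) = psi (pt (conjv y), pt (conjv x)).
Proof.
move=> x0 y0; apply: val_inj; rewrite psi_pt ?conjv_eq0 // psivec_conj.
by rewrite val_qconj psi_pt // pconj_pt // psivec_nz.
Qed.

Lemma dot_conj x y : dot (conjv y) (conjv x) = conjc (dot x y).
Proof. by rewrite /dot !mxE rmorphD !rmorphM ![_ * conjc (x 0 _)]mulrC. Qed.

Lemma sph_conj w : sph (qconj R w) <-> sph w.
Proof.
have [v [v0 e]] := ptP (val w).
by rewrite /sph /mkset val_qconj e pconj_pt // !chart_pt ?conjv_eq0 // mxE conjc_eq0.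
Qed.

Lemma ringed_quadricC : ringed (quadricC R).
Proof. exact/ringed_subspace/ringed_projspace. Qed.

Lemma sph_open : copen sph.
Proof.
have [o _] := @semireg_val R _ (@on_quadric R) (ringed_projspace R 3) _ (@chart_open R 3 T).
by move: o; rewrite setTI.
Qed.

Lemma scoord_reg k : creg sph (fun w => scoord w 0 k).
Proof.
have [_ /(_ _ (hcoord_reg R T k))] := @semireg_val R _ (@on_quadric R) (ringed_projspace R 3) _ (@chart_open R 3 T).
by rewrite setTI.
Qed.

Lemma ringed_P1P1 : ringed (prodspace (projspace R 1) (projspace R 1)).
Proof. by apply: ringed_prodspace; exact: ringed_projspace. Qed.

Lemma semireg_psi : semireg idfun setT (@psi R).
Proof.
have rP := ringed_projspace R 1; have rPP := ringed_P1P1.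
apply: semireg_subspace => //; apply: semireg_loc => // -[p q] _.
have [i pi] := chart_cover p; have [j qj] := chart_cover q.
pose M := [set z : prodspace (projspace R 1) (projspace R 1) | chart i z.1 /\ chart j z.2].
have [o1 r1] := semireg_fst rP rP (@chart_open R 1 i).
have [o2 r2] := semireg_snd rP rP (@chart_open R 1 j).
rewrite !setTI in o1 o2 r1 r2.
have oM : copen M by exact: openI o1 o2.
have r1' k : creg M (fun z => hcoord i z.1 0 k).
  by apply: (reg_sub rPP oM (r1 _ (hcoord_reg R i k))) => z [].
have r2' k : creg M (fun z => hcoord j z.2 0 k).
  by apply: (reg_sub rPP oM (r2 _ (hcoord_reg R j k))) => z [].
have n0 z : M z -> hcoord i z.1 != 0 /\ hcoord j z.2 != 0.
  by move=> [z1 z2]; split; exact: hcoord_neq0.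
exists M, (fun z => pt (psivec (hcoord i z.1) (hcoord j z.2))); split=> //.
- apply: semireg_pt => //; last by move=> z /n0[]; exact: psivec_nz.
  have rM := regM rPP; have rD := regD rPP; have rB := regB rPP.
  have rI := reg_cst rPP 'i%C oM.
  by apply: I4P; under eq_fun do rewrite mxE inordK //=; auto.
- move=> z Mz; have [z1 z2] := Mz; have [n1 n2] := n0 z Mz.
  by rewrite -psi_pt // !pt_hcoord //; case: (z).
Qed.

End Quadric.

(** * The trivialization *)

Section BundleOperations.
Context (R : realType) (X Y : cspace R) (s : real_structure Y).

Lemma fib_transport (f : X -> Y) (F : cbundle X) y e :
  fib (transport f F) y e <-> exists x, f x = y /\ fib F x e.
Proof. by []. Qed.

Lemma fib_pullback (f : Y -> X) (F : cbundle X) y e :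
  fib (pullback f F) y e <-> (val e).1 = y.
Proof. by []. Qed.

Lemma fib_dsum (F : cbundle Y) y z :
  fib (dsum s F) y z <-> fib F y (val z).1 /\ fib F (s y) (val z).2.
Proof. by []. Qed.

Lemma lincomb_dsum (F : cbundle Y) a u v w : lincomb (dsum s F) a u v w <->
  [/\ exists y, [/\ fib (dsum s F) y u, fib (dsum s F) y v & fib (dsum s F) y w],
      lincomb F a (val u).1 (val v).1 (val w).1 &
      lincomb F (conjc a) (val u).2 (val v).2 (val w).2].
Proof. by []. Qed.

Lemma fst_dswap (F : cbundle Y) z : (val (dswap s F z)).1 = (val z).2.
Proof. by []. Qed.

End BundleOperations.

Section Trivialization.
Context (R : realType) (n : nat).
Local Notation C := R[i].
Local Notation T := (inord 3 : 'I_4).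
Local Notation conjv := (map_mx (@conjc R)).
Implicit Types x y : 'rV[C]_2.

(** The trivialization requires a unimodular completion of the row
    (x_0^n, x_1^n) over the ring of functions of the sphere. When
    x_0 y_0 + x_1 y_1 = 1, the powers x_0^n y_0^n and x_1^n y_1^n are the values
    at X = x_0 y_0 of the coprime polynomials X^n and (1 - X)^n. *)
Lemma bezout_powers : exists ab : {poly C} * {poly C},
  ab.1 * 'X^n + ab.2 * (1 - 'X) ^+ n = 1.
Proof.
have : coprimep ('X^n : {poly C}) ((1 - 'X) ^+ n).
  apply/coprimep_expl/coprimep_expr/Bezout_eq1_coprimepP.
  by exists (1, 1); rewrite !mul1r addrC subrK.
by case/Bezout_eq1_coprimepP => ab; exists ab.
Qed.

Definition alpha x y : C := (projT1 (cid bezout_powers)).1.[x 0 0 * y 0 0].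
Definition beta x y : C := (projT1 (cid bezout_powers)).2.[x 0 0 * y 0 0].

Lemma bezout_dot x y : dot x y = 1 ->
  alpha x y * (x 0 0 * y 0 0) ^+ n + beta x y * (x 0 1 * y 0 1) ^+ n = 1.
Proof.
move=> d1; rewrite /alpha /beta; case: cid => -[a b] /= e.
have := congr1 (horner^~ (x 0 0 * y 0 0)) e.
rewrite !hornerE => <-; congr (_ + _ * _ ^+ _).
by rewrite -d1 /dot; ring.
Qed.

(** The trivialization: (a, b) goes to (fibv, fibu), with inverse (coA, coB). Its
    matrix
      (   x_0^n         x_1^n      )
      ( -y_1^n beta   y_0^n alpha  )
    has determinant 1 when dot x y = 1. *)
Definition fibv x a b : C := x 0 0 ^+ n * a + x 0 1 ^+ n * b.
Definition fibu x y a b : C :=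
  y 0 0 ^+ n * alpha x y * b - y 0 1 ^+ n * beta x y * a.
Definition coA x y v u : C := y 0 0 ^+ n * alpha x y * v - x 0 1 ^+ n * u.
Definition coB x y v u : C := y 0 1 ^+ n * beta x y * v + x 0 0 ^+ n * u.

Lemma coA_fib x y a b : dot x y = 1 ->
  coA x y (fibv x a b) (fibu x y a b) = a.
Proof.
move=> /bezout_dot e; rewrite -[RHS]mul1r -e !exprMn /coA /fibv /fibu; ring.
Qed.

Lemma coB_fib x y a b : dot x y = 1 ->
  coB x y (fibv x a b) (fibu x y a b) = b.
Proof.
move=> /bezout_dot e; rewrite -[RHS]mul1r -e !exprMn /coB /fibv /fibu; ring.
Qed.

Lemma fibv_co x y v u : dot x y = 1 -> fibv x (coA x y v u) (coB x y v u) = v.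
Proof.
move=> /bezout_dot e; rewrite -[RHS]mul1r -e !exprMn /coA /coB /fibv; ring.
Qed.

Lemma fibu_co x y v u : dot x y = 1 -> fibu x y (coA x y v u) (coB x y v u) = u.
Proof.
move=> /bezout_dot e; rewrite -[RHS]mul1r -e !exprMn /coA /coB /fibu; ring.
Qed.

(** The coordinates depend only on the point of the bundle: the representatives
    (x, y) with dot x y = 1 differ by (t, s) with t s = 1, and both [alpha] and
    [beta] are functions of x_0 y_0. *)
Lemma co_inv t s x y v u : t * s = 1 ->
  coA (t *: x) (s *: y) (t ^+ n * v) (s ^+ n * u) = coA x y v u /\
  coB (t *: x) (s *: y) (t ^+ n * v) (s ^+ n * u) = coB x y v u.
Proof.
move=> ts; have tsn : t ^+ n * s ^+ n = 1 by rewrite -exprMn ts expr1n.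
have e : (t * x 0 0) * (s * y 0 0) = x 0 0 * y 0 0 by rewrite mulrACA ts mul1r.
rewrite /coA /coB /alpha /beta !mxE e !exprMn; case: cid => -[a b] /= _.
split; rewrite -[RHS]mul1r -tsn; ring.
Qed.

Local Notation L := (Lbundle R n).
Local Notation E := (dsum (qconj R) L).

Definition lbase (e : tot L) : prodspace (projspace R 1) (projspace R 1) :=
  (val e).1.
Definition lvec (e : tot L) : quotspace (@Oequiv R n) := (val e).2.

Lemma lvec_fib e : fib (Obundle R n) (lbase e).1 (lvec e).
Proof. exact: (set_mem (valP e)). Qed.

Lemma Ltot_mk p o : fib (Obundle R n) p.1 o ->
  exists e : tot L, lbase e = p /\ lvec e = o.
Proof.
move=> h; have h' : [set z : prodspace (prodspace (projspace R 1) (projspace R 1)) (tot (Obundle R n)) |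
    fib (Obundle R n) z.1.1 z.2] (p, o) by [].
by exists (SigSub (mem_set h')).
Qed.

Lemma Ltot_inj e e' : lbase e = lbase e' -> lvec e = lvec e' -> e = e'.
Proof.
move=> h1 h2; apply: val_inj; move: h1 h2; rewrite /lbase /lvec.
by case: (val e) (val e') => [? ?] [? ?] /= -> ->.
Qed.

Lemma fib_L w e : fib L w e <-> psi (lbase e) = w.
Proof.
rewrite /Lbundle fib_transport; split=> [[p [pw ep]]|ew].
  by move/fib_pullback: ep => ep; rewrite -pw -ep.
by exists (lbase e); split=> //; apply/fib_pullback.
Qed.

Definition dfst (z : tot E) : tot L := (val z).1.
Definition dsnd (z : tot E) : tot L := (val z).2.
Definition dproj (z : tot E) : quadricC R := psi (lbase (dfst z)).

Lemma dsnd_base z : psi (lbase (dsnd z)) = qconj R (dproj z).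
Proof.
have [w [/fib_L e1 /fib_L e2]] := set_mem (valP z).
by rewrite /dproj /dfst e1 -e2.
Qed.

Lemma fib_E w z : fib E w z <-> dproj z = w.
Proof.
rewrite fib_dsum !fib_L; split=> [[]//|<-].
by split; last exact: dsnd_base.
Qed.

Lemma E_mk e e' : psi (lbase e') = qconj R (psi (lbase e)) ->
  exists z : tot E, dfst z = e /\ dsnd z = e'.
Proof.
move=> h; have h' : dset (qconj R) (E := L) (e, e').
  by exists (psi (lbase e)); split; apply/fib_L.
by exists (SigSub (mem_set h')).
Qed.

Lemma E_inj z z' : dfst z = dfst z' -> dsnd z = dsnd z' -> z = z'.
Proof.
move=> h1 h2; apply: val_inj; move: h1 h2; rewrite /dfst /dsnd.
by case: (val z) (val z') => [? ?] [? ?] /= -> ->.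
Qed.

Lemma lincomb_E a z1 z2 z3 : lincomb E a z1 z2 z3 <->
  [/\ dproj z1 = dproj z2 /\ dproj z3 = dproj z2,
      [/\ lbase (dfst z1) = lbase (dfst z2), lbase (dfst z3) = lbase (dfst z2) &
        lincomb (Obundle R n) a (lvec (dfst z1)) (lvec (dfst z2)) (lvec (dfst z3))] &
      [/\ lbase (dsnd z1) = lbase (dsnd z2), lbase (dsnd z3) = lbase (dsnd z2) &
        lincomb (Obundle R n) (conjc a) (lvec (dsnd z1)) (lvec (dsnd z2)) (lvec (dsnd z3))]].
Proof.
rewrite lincomb_dsum; split=> [[[w [/fib_E e1 /fib_E e2 /fib_E e3]] h1 h2]|[[e1 e2] h1 h2]].
  by split; [rewrite e1 e2 e3|exact: h1|exact: h2].
split; [|exact: h1|exact: h2].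
by exists (dproj z2); split; apply/fib_E.
Qed.

(** The second summand is the conjugate of a bundle, so its fibre coordinate
    which is a regular function of the point is [u], the conjugate of the one
    that O(n) provides. *)
Record drep (z : tot E) x y (v u : C) : Prop := Drep {
  drep_dot : dot x y = 1;
  drep_base1 : lbase (dfst z) = (pt x, pt y);
  drep_vec1 : lvec (dfst z) = opt n x v;
  drep_base2 : lbase (dsnd z) = (pt (conjv y), pt (conjv x));
  drep_vec2 : lvec (dsnd z) = opt n (conjv y) (conjc u) }.

Lemma drep_proj z x y v u : drep z x y v u -> dproj z = psi (pt x, pt y).
Proof. by case=> d1 b1 _ _ _; rewrite /dproj b1. Qed.

Lemma opt_over x e p : x != 0 -> fib (Obundle R n) p e -> p = pt x ->
  exists v, e = opt n x v.
Proof.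
move=> x0 /fib_Obundle[y [w [y0 -> ->]]] /(pt_inj y0 x0)[t [t0 ->]].
by exists (t ^+ n * w); rewrite optZ.
Qed.

Lemma drep_ex z x y : dot x y = 1 -> dproj z = psi (pt x, pt y) ->
  exists v u, drep z x y v u.
Proof.
move=> d1 zw; have [x0 y0] := dot_neq0 d1.
have b1 : lbase (dfst z) = (pt x, pt y) by exact: psi_inj_sph.
have b2 : lbase (dsnd z) = (pt (conjv y), pt (conjv x)).
  apply: psi_inj_sph; first by rewrite dot_conj d1 rmorph1.
  by rewrite dsnd_base zw qconj_psi.
have [v ve] : exists v, lvec (dfst z) = opt n x v.
  by apply: opt_over x0 (lvec_fib _) _; rewrite b1.
have [u ue] : exists u, lvec (dsnd z) = opt n (conjv y) u.
  by apply: opt_over (lvec_fib _) _; rewrite ?conjv_eq0 // b2.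
by exists v, (conjc u); split=> //; rewrite conjcK.
Qed.

Lemma drep_mk x y v u : dot x y = 1 -> exists z, drep z x y v u.
Proof.
move=> d1; have [x0 y0] := dot_neq0 d1.
have [e [b1 v1]] : exists e : tot L, lbase e = (pt x, pt y) /\ lvec e = opt n x v.
  by apply: Ltot_mk; apply/fib_Obundle; exists x, v.
have [e' [b2 v2]] : exists e : tot L, lbase e = (pt (conjv y), pt (conjv x)) /\
    lvec e = opt n (conjv y) (conjc u).
  by apply: Ltot_mk; apply/fib_Obundle; exists (conjv y), (conjc u); rewrite conjv_eq0.
have [|z [z1 z2]] := @E_mk e e'; first by rewrite b1 b2 qconj_psi.
by exists z; split; rewrite ?z1 ?z2.
Qed.

Lemma drep_eq z z' x y v u : drep z x y v u -> drep z' x y v u -> z = z'.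
Proof.
move=> [_ a1 a2 a3 a4] [_ b1 b2 b3 b4].
by apply: E_inj; apply: Ltot_inj; congruence.
Qed.

Lemma drep_scale z t s x y v u : t * s = 1 -> drep z x y v u ->
  drep z (t *: x) (s *: y) (t ^+ n * v) (s ^+ n * u).
Proof.
move=> ts [d1 b1 v1 b2 v2]; have [x0 y0] := dot_neq0 d1.
have t0 : t != 0 by apply: contra_eq_neq ts => ->; rewrite mul0r eq_sym oner_neq0.
have s0 : s != 0 by apply: contra_eq_neq ts => ->; rewrite mulr0 eq_sym oner_neq0.
split.
- by rewrite /dot !mxE mulrACA [t * x 0 1 * _]mulrACA ts !mul1r.
- by rewrite !ptZ.
- by rewrite optZ.
- by rewrite !map_mxZ !ptZ ?conjv_eq0 ?conjc_eq0.
- by rewrite map_mxZ rmorphM rmorphXn optZ ?conjv_eq0 ?conjc_eq0.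
Qed.

Lemma opt_injv x v w : x != 0 -> opt n x v = opt n x w -> v = w.
Proof.
move=> x0 /(opt_inj x0 x0)[t [t0 e ->]].
have /rV0Pn[i xi] := x0.
have -> : t = 1 by apply: (mulIf xi); move/rowP/(_ i): e; rewrite mxE mul1r => <-.
by rewrite expr1n mul1r.
Qed.

Lemma drep_inj z x y v u v' u' : drep z x y v u -> drep z x y v' u' ->
  v = v' /\ u = u'.
Proof.
move=> [d1 _ a2 _ a4] [_ _ b2 _ b4]; have [x0 y0] := dot_neq0 d1.
split; first by apply: (@opt_injv x) => //; congruence.
apply: (can_inj (@conjcK R)); apply: (@opt_injv (conjv y)); first by rewrite conjv_eq0.
by rewrite -a4 -b4.
Qed.

Lemma drep_uniq z x y v u x' y' v' u' :
  drep z x y v u -> drep z x' y' v' u' -> exists t s,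
  [/\ t * s = 1, x' = t *: x, y' = s *: y, v' = t ^+ n * v & u' = s ^+ n * u].
Proof.
move=> r r'; have d1 := drep_dot r; have d1' := drep_dot r'.
have := drep_proj r'; rewrite (drep_proj r) => /(congr1 (@scoord R)).
rewrite !scoord_psi // => /(psivec_eq d1 d1')[t [s [ts ex ey]]].
exists t, s; split=> //; have := drep_scale ts r; rewrite -ex -ey => r2.
  by have [] := drep_inj r' r2.
by have [] := drep_inj r' r2.
Qed.

Lemma sph_drep z : sph (dproj z) -> exists x y v u, drep z x y v u.
Proof. by move=> /sph_rep[x [y [d1 /(drep_ex d1)[v [u r]]]]]; exists x, y, v, u. Qed.

(** The pair of functions giving the trivialization; 0 is a junk value, off the
    affine sphere. *)
Definition dcoord (z : tot E) : 'rV[C]_2 :=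
  match pselect (exists d : 'rV[C]_2 * 'rV[C]_2 * C * C,
    drep z d.1.1.1 d.1.1.2 d.1.2 d.2) with
  | left h => let d := projT1 (cid h) in
      \row_k (if k == 0 then coA d.1.1.1 d.1.1.2 d.1.2 d.2
              else coB d.1.1.1 d.1.1.2 d.1.2 d.2)
  | right _ => 0
  end.

Lemma dcoordE z x y v u : drep z x y v u ->
  dcoord z = \row_k (if k == 0 then coA x y v u else coB x y v u).
Proof.
move=> r; rewrite /dcoord; case: pselect => [h|[]]; last by exists (x, y, v, u).
case: cid => -[[[x' y'] v'] u'] /= r'.
have [t [s [ts -> -> -> ->]]] := drep_uniq r r'.
by have [eA eB] := co_inv x y v u ts; apply/rowP => k; rewrite !mxE eA eB.
Qed.

Lemma drep_fib z x y v u : drep z x y v u ->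
  v = fibv x (dcoord z 0 0) (dcoord z 0 1) /\ u = fibu x y (dcoord z 0 0) (dcoord z 0 1).
Proof.
move=> r; rewrite (dcoordE r) !mxE /=.
by rewrite fibv_co ?fibu_co //; exact: drep_dot r.
Qed.

Lemma dcoord_inj z z' : sph (dproj z) -> dproj z = dproj z' -> dcoord z = dcoord z' ->
  z = z'.
Proof.
move=> /sph_drep[x [y [v [u r]]]] e ec.
have [v' [u' r']] : exists v' u', drep z' x y v' u'.
  by apply: drep_ex; [exact: drep_dot r|rewrite -e (drep_proj r)].
apply: (drep_eq r); have [-> ->] := drep_fib r.
by rewrite ec; have [<- <-] := drep_fib r'.
Qed.

Lemma dcoord_surj w c : sph w -> exists z, dproj z = w /\ dcoord z = c.
Proof.
move=> /sph_rep[x [y [d1 ->]]].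
have [z r] := drep_mk (fibv x (c 0 0) (c 0 1)) (fibu x y (c 0 0) (c 0 1)) d1.
exists z; split; first exact: drep_proj r.
rewrite (dcoordE r) coA_fib // coB_fib //.
by apply/rowP => k; rewrite mxE; case: (I2P k) => ->.
Qed.

(** On a fixed fibre the coordinates are linear isomorphisms of (v, u), and the
    conjugate scalars of the second summand cancel the conjugation in [u]. *)
Lemma lincomb_dcoord a z1 z2 z3 : sph (dproj z2) ->
  lincomb E a z1 z2 z3 <->
  [/\ dproj z1 = dproj z2, dproj z3 = dproj z2 &
      dcoord z3 = a *: dcoord z1 + dcoord z2].
Proof.
move=> sz; have [x [y [v2 [u2 r2]]]] := sph_drep sz; have d1 := drep_dot r2.
have [x0 y0] := dot_neq0 d1.
have ex z : dproj z = dproj z2 -> exists v u, drep z x y v u.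
  by move=> e; apply: drep_ex => //; rewrite e (drep_proj r2).
have lo x' b v w t : x' != 0 ->
    lincomb (Obundle R n) b (opt n x' v) (opt n x' w) (opt n x' t) <-> t = b * v + w.
  move=> x'0; split=> [|->]; last by apply/lincomb_Obundle; exists x', v, w.
  move=> /lincomb_Obundle[x1 [v1 [w1 [x10]]]].
  move=> /(opt_inj x'0 x10)[t1 [t10 ex1 ->]].
  have et v0 : opt n x' v0 = opt n x1 (t1 ^+ n * v0) by rewrite ex1 optZ.
  rewrite !et => /(opt_injv x10) <- /(opt_injv x10).
  rewrite mulrCA -mulrDr; apply: mulfI; exact: expf_neq0.
suff key v1 u1 v3 u3 : drep z1 x y v1 u1 -> drep z3 x y v3 u3 ->
    (dcoord z3 = a *: dcoord z1 + dcoord z2) <-> v3 = a * v1 + v2 /\ u3 = a * u1 + u2.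
  rewrite lincomb_E; split.
    move=> [[e1 e3] [_ _ l1] [_ _ l2]]; split=> //.
    have [v1 [u1 r1]] := ex _ e1; have [v3 [u3 r3]] := ex _ e3.
    apply/(key _ _ _ _ r1 r3).
    move: l1 l2; rewrite !(drep_vec1 r1, drep_vec1 r2, drep_vec1 r3).
    rewrite !(drep_vec2 r1, drep_vec2 r2, drep_vec2 r3).
    move=> /(lo _ _ _ _ _ x0) -> /lo; rewrite conjv_eq0 => /(_ y0).
    by rewrite -rmorphM -rmorphD => /(can_inj (@conjcK R)).
  move=> [e1 e3 ec].
  have [v1 [u1 r1]] := ex _ e1; have [v3 [u3 r3]] := ex _ e3.
  have [ev eu] := (key _ _ _ _ r1 r3).1 ec.
  rewrite !(drep_vec1 r1, drep_vec1 r2, drep_vec1 r3).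
  rewrite !(drep_vec2 r1, drep_vec2 r2, drep_vec2 r3).
  rewrite !(drep_base1 r1, drep_base1 r2, drep_base1 r3).
  rewrite !(drep_base2 r1, drep_base2 r2, drep_base2 r3).
  split=> //; split=> //; apply/lo; rewrite ?conjv_eq0 //.
  by rewrite eu rmorphD rmorphM.
move=> r1 r3; split=> [ec|[e1 e2]]; last first.
  rewrite (dcoordE r1) (dcoordE r2) (dcoordE r3) e1 e2.
  by apply/rowP => k; rewrite !mxE /coA /coB; case: ifP => _; ring.
have [ev1 eu1] := drep_fib r1; have [ev2 eu2] := drep_fib r2.
have [-> ->] := drep_fib r3; rewrite ec !mxE ev1 eu1 ev2 eu2 /fibv /fibu.
by split; ring.
Qed.

End Trivialization.

Section TrivializationRegular.
Context (R : realType) (n : nat).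
Local Notation C := R[i].
Local Notation conjv := (map_mx (@conjc R)).
Local Notation L := (Lbundle R n).
Local Notation E := (dsum (qconj R) L).

Lemma ringed_Ltot : ringed (tot L).
Proof.
apply: ringed_subspace; apply: ringed_prodspace; first exact: ringed_P1P1.
exact: ringed_Otot.
Qed.

Lemma ringed_Etot : ringed (tot E).
Proof.
apply: ringed_subspace; apply: ringed_prodspace; first exact: ringed_Ltot.
exact/ringed_conjspace/ringed_Ltot.
Qed.

Lemma semireg_lbase : semireg idfun setT (@lbase R n).
Proof.
have rPP := ringed_P1P1 R; have rO := ringed_Otot R n.
apply: (@semireg_comp _ _ _ _ _ setT setT _ _ (semireg_val _ (ringed_prodspace rPP rO))) => //.
exact: (semireg_fst rPP rO).
Qed.

Lemma semireg_lvec : semireg idfun setT (@lvec R n).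
Proof.
have rPP := ringed_P1P1 R; have rO := ringed_Otot R n.
apply: (@semireg_comp _ _ _ _ _ setT setT _ _ (semireg_val _ (ringed_prodspace rPP rO))) => //.
exact: (semireg_snd rPP rO).
Qed.

Lemma semireg_dfst : semireg idfun setT (@dfst R n).
Proof.
have rL := ringed_Ltot; have rL' := ringed_conjspace rL.
apply: (@semireg_comp _ _ _ _ _ setT setT _ _ (semireg_val _ (ringed_prodspace rL rL'))) => //.
exact: (semireg_fst rL rL').
Qed.

Lemma semireg_dsnd : @semireg R idfun (tot E) (conjspace (tot L)) setT (@dsnd R n).
Proof.
have rL := ringed_Ltot; have rL' := ringed_conjspace rL.
apply: (@semireg_comp _ _ _ _ _ setT setT _ _ (semireg_val _ (ringed_prodspace rL rL'))) => //.
exact: (semireg_snd rL rL').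
Qed.

Lemma semireg_dproj : semireg idfun setT (@dproj R n).
Proof.
apply: (@semireg_comp _ _ _ _ _ setT setT _ _ _ (@semireg_psi R)) => //.
exact: (@semireg_comp _ _ _ _ _ setT setT _ _ semireg_dfst semireg_lbase).
Qed.

Definition dsph : set (tot E) := [set z | sph (dproj z)].

Lemma dsph_open : copen dsph.
Proof. by have [o _] := semireg_dproj (@sph_open R); rewrite setTI in o. Qed.

Lemma scoord_dproj_reg k : creg dsph (fun z => scoord (dproj z) 0 k).
Proof.
by have [_ /(_ _ (scoord_reg R k))] := semireg_dproj (@sph_open R); rewrite setTI.
Qed.

Let p1 (z : tot E) : projspace R 1 := (lbase (dfst z)).1.
Let p2 (z : tot E) : projspace R 1 := (lbase (dfst z)).2.

Lemma semireg_p1 : semireg idfun setT p1.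
Proof.
have rP := ringed_projspace R 1.
apply: (@semireg_comp _ _ _ _ _ setT setT _ _ _ (semireg_fst rP rP)) => //.
exact: (@semireg_comp _ _ _ _ _ setT setT _ _ semireg_dfst semireg_lbase).
Qed.

Lemma semireg_p2 : semireg idfun setT p2.
Proof.
have rP := ringed_projspace R 1.
apply: (@semireg_comp _ _ _ _ _ setT setT _ _ _ (semireg_snd rP rP)) => //.
exact: (@semireg_comp _ _ _ _ _ setT setT _ _ semireg_dfst semireg_lbase).
Qed.

Lemma semireg_lvec1 : semireg idfun setT (fun z : tot E => lvec (dfst z)).
Proof. exact: (@semireg_comp _ _ _ _ _ setT setT _ _ semireg_dfst semireg_lvec). Qed.

Lemma semireg_lvec2 : @semireg R idfun (tot E) (conjspace (quotspace (@Oequiv R n)))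
  setT (fun z : tot E => lvec (dsnd z)).
Proof.
exact: (@semireg_comp _ _ _ _ _ setT setT _ _ semireg_dsnd (semireg_of_conjspace semireg_lvec)).
Qed.

(** Locally the two homogeneous coordinates can be normalized by their [i]-th
    and [j]-th entries; dividing the second one by the pairing [d] gives
    representatives with dot product 1 that are regular functions. *)
Lemma dcoord_reg k : creg dsph (fun z => dcoord z 0 k).
Proof.
have rE := ringed_Etot; have rM := regM rE; have rD := regD rE; have rB := regB rE.
apply: (reg_loc rE) => [|z0 sz0]; first exact: dsph_open.
have [i ci] := chart_cover (p1 z0); have [j cj] := chart_cover (p2 z0).
have [o1 r1] := semireg_p1 (@chart_open R 1 i).
have [o2 r2] := semireg_p2 (@chart_open R 1 j).
have [o3 r3] := semireg_lvec1 (@ochart_open R n i).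
have [o4 r4] := semireg_lvec2 (@ochart_open R n j).
rewrite !setTI in o1 o2 o3 o4 r1 r2 r3 r4.
pose M := dsph `&` (p1 @^-1` chart i `&` p2 @^-1` chart j) `&`
  ((fun z : tot E => lvec (dfst z)) @^-1` ochart i `&`
   (fun z : tot E => lvec (dsnd z)) @^-1` ochart j).
have oM : copen M.
  by apply: (openI rE); apply: (openI rE) => //; [exact: dsph_open|exact: (openI rE)].
have rx l : creg M (fun z => hcoord i (p1 z) 0 l).
  by apply: (reg_sub rE oM (r1 _ (hcoord_reg R i l))) => z [[_ []]].
have ry l : creg M (fun z => hcoord j (p2 z) 0 l).
  by apply: (reg_sub rE oM (r2 _ (hcoord_reg R j l))) => z [[_ []]].
have rv : creg M (fun z => ocoord i (lvec (dfst z))).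
  by apply: (reg_sub rE oM (r3 _ (ocoord_reg R n i))) => z [_ []].
have ru : creg M (fun z => conjc (ocoord j (lvec (dsnd z)))).
  by apply: (reg_sub rE oM (r4 _ (conjspace_reg (ocoord_reg R n j)))) => z [_ []].
have co z : M z -> exists x y v u,
    [/\ drep z x y v u, x 0 i != 0 & y 0 j != 0].
  move=> [[sz [zi zj]] _]; have [x [y [v [u r]]]] := sph_drep sz.
  have [x0 y0] := dot_neq0 (drep_dot r).
  exists x, y, v, u; split=> //.
    by move: zi; rewrite /preimage /= /p1 (drep_base1 r) => /(chart_pt _ x0).
  by move: zj; rewrite /preimage /= /p2 (drep_base1 r) => /(chart_pt _ y0).
pose d z := dot (hcoord i (p1 z)) (hcoord j (p2 z)).
have rd : creg M d by apply: rD; apply: rM.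
have dE z x y v u : drep z x y v u -> d z = (x 0 i * y 0 j)^-1.
  move=> r; have [x0 y0] := dot_neq0 (drep_dot r).
  rewrite /d /p1 /p2 (drep_base1 r) !hcoord_pt // invfM -[RHS]mulr1 -(drep_dot r) /dot !mxE.
  by ring.
have d0 z : M z -> d z != 0.
  by move=> /co[x [y [v [u [r xi yj]]]]]; rewrite (dE _ _ _ _ _ r) invr_neq0 ?mulf_neq0.
pose X (z : tot E) := hcoord i (p1 z); pose Y (z : tot E) : 'rV[C]_2 := (d z)^-1 *: hcoord j (p2 z).
pose v (z : tot E) : C := ocoord i (lvec (dfst z)).
pose u (z : tot E) : C := conjc (ocoord j (lvec (dsnd z))) / d z ^+ n.
have rdV := reg_inv rE rd d0.
have rY l : creg M (fun z => Y z 0 l).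
  by under eq_fun do rewrite mxE; exact: rM.
have ru' : creg M u by apply: rM => //; apply: (reg_inv rE (regX rE n rd)) => z /d0; exact: expf_neq0.
have rXY : creg M (fun z => X z 0 0 * Y z 0 0) by exact: rM.
have ral : creg M (fun z => alpha n (X z) (Y z)) by exact: (reg_horner rE _ rXY).
have rbe : creg M (fun z => beta n (X z) (Y z)) by exact: (reg_horner rE _ rXY).
have rX := regX rE n.
exists M, (fun z => if k == 0 then coA n (X z) (Y z) (v z) (u z) else coB n (X z) (Y z) (v z) (u z)).
split.
- by case: (k == 0); [apply: (rB)|apply: (rD)]; apply: (rM); auto.
- have [x [y [v0 [w0 r]]]] := sph_drep sz0; have [x0 y0] := dot_neq0 (drep_dot r).
  have xi : x 0 i != 0 by move: ci; rewrite /p1 (drep_base1 r) => /(chart_pt _ x0).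
  have yj : y 0 j != 0 by move: cj; rewrite /p2 (drep_base1 r) => /(chart_pt _ y0).
  split; first by [].
  split; rewrite /preimage /=; first by rewrite (drep_vec1 r); apply/ochart_opt.
  by rewrite (drep_vec2 r); apply/ochart_opt; rewrite ?conjv_eq0 // mxE conjc_eq0.
- move=> z _ Mz; have [x [y [v0 [w0 [r xi yj]]]]] := co z Mz.
  have [x0 y0] := dot_neq0 (drep_dot r).
  have ts : (x 0 i)^-1 * x 0 i = 1 by rewrite mulVf.
  have := drep_scale ts r.
  have -> : (x 0 i)^-1 *: x = X z by rewrite /X /p1 (drep_base1 r) hcoord_pt.
  have -> : x 0 i *: y = Y z.
    rewrite /Y (dE _ _ _ _ _ r) invrK /p2 (drep_base1 r) hcoord_pt // scalerA.
    by rewrite mulfK.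
  have -> : (x 0 i)^-1 ^+ n * v0 = v z.
    by rewrite /v (drep_vec1 r) ocoord_opt // exprVn mulrC.
  have -> : x 0 i ^+ n * w0 = u z.
    rewrite /u (drep_vec2 r) ocoord_opt ?conjv_eq0 // (dE _ _ _ _ _ r) mxE.
    have -> : conjc (conjc w0 / conjc (y 0 j) ^+ n) = w0 / y 0 j ^+ n.
      by rewrite -(rmorphXn (@conjc R)) -(fmorph_div (@conjc R)) conjcK.
    rewrite exprVn invrK exprMn.
    by rewrite [in RHS](mulrC (x 0 i ^+ n)) mulrA mulfVK ?expf_neq0 // mulrC.
  by move=> /dcoordE ->; rewrite mxE.
Qed.

Section Inverse.
Context (Z : cspace R) (w : Z -> quadricC R) (c : Z -> 'rV[C]_2) (th : Z -> tot E).
Hypotheses (rZ : ringed Z) (w_sph : forall z, sph (w z)).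
Hypotheses (w_reg : forall k, @creg R Z setT (fun z => scoord (w z) 0 k)).
Hypotheses (c_reg : forall k, @creg R Z setT (fun z => c z 0 k)).
Hypotheses (thw : forall z, dproj (th z) = w z) (thc : forall z, dcoord (th z) = c z).

(** The inverse of the trivialization is regular: on the open set where the
    [i]-th diagonal entry of the matrix of the point does not vanish, [liftx] and
    [lifty] are regular homogeneous coordinates of that point, and the components
    in the fibre are polynomials in these and in the coordinates [c]. *)
Lemma semireg_total : semireg idfun setT th.
Proof.
pose X i z := liftx i (scoord (w z)); pose Y i z := lifty i (scoord (w z)).
pose v i z := fibv n (X i z) (c z 0 0) (c z 0 1).
pose u i z := fibu n (X i z) (Y i z) (c z 0 0) (c z 0 1).
pose M i : set Z := [set z | seg (scoord (w z)) i i != 0].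
have rM := regM rZ; have rD := regD rZ; have rB := regB rZ; have rC := @reg_cst _ _ rZ setT.
have oT := openT rZ.
have rseg i j : @creg R Z setT (fun z => seg (scoord (w z)) i j).
  by apply: (rM); [rewrite /seg; case: (i == 0); case: (j == 0); auto|exact: rC].
have oM i : copen (M i) by have := open_neq0 rZ (rseg i i); rewrite setTI.
have sM i f : @creg R Z setT f -> creg (M i) f by move=> rf; exact: (reg_sub rZ (oM i) rf).
have rX i k : creg (M i) (fun z => X i z 0 k).
  by under eq_fun do rewrite mxE; exact: sM.
have rY i k : creg (M i) (fun z => Y i z 0 k).
  under eq_fun do rewrite mxE; apply: (rM); first exact: sM.
  by apply: (reg_inv rZ) => //; exact: sM.
have rXY i : creg (M i) (fun z => X i z 0 0 * Y i z 0 0) by exact: rM.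
have rXn i k : creg (M i) (fun z => X i z 0 k ^+ n) by exact: (regX rZ).
have rYn i k : creg (M i) (fun z => Y i z 0 k ^+ n) by exact: (regX rZ).
have rc i k : creg (M i) (fun z => c z 0 k) by exact: sM.
have ral i : creg (M i) (fun z => alpha n (X i z) (Y i z)) by exact: (reg_horner rZ _ (rXY i)).
have rbe i : creg (M i) (fun z => beta n (X i z) (Y i z)) by exact: (reg_horner rZ _ (rXY i)).
have rv i : creg (M i) (v i) by apply: (rD); apply: (rM).
have ru i : creg (M i) (u i) by apply: (rB); apply: (rM) => //; apply: (rM).
have thr i z : M i z -> drep (th z) (X i z) (Y i z) (v i z) (u i z).
  move=> Mz; have e := psivec_lift (scoord_qform (w z)) Mz.
  have d1 : dot (X i z) (Y i z) = 1 by rewrite -psivec_T e scoord_T.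
  have [x0 y0] := dot_neq0 d1.
  have pw : psi (pt (X i z), pt (Y i z)) = w z.
    apply: (scoord_inj _ (w_sph z)); last by rewrite (scoord_psi d1) e.
    by apply/(sph_psi x0 y0); rewrite d1 oner_neq0.
  have [v' [u' r]] : exists v' u', drep (th z) (X i z) (Y i z) v' u'.
    by apply: drep_ex => //; rewrite pw thw.
  by have [ev eu] := drep_fib r; rewrite /v /u -thc -ev -eu.
have cov z : exists i, M i z by exact: sph_lift.
have nz i z : M i z -> X i z != 0 /\ Y i z != 0 by move=> /thr/drep_dot/dot_neq0.
have rPP := ringed_P1P1 R; have rO := ringed_Otot R n.
have leaf (cc : {rmorphism C -> C}) (Y0 : cspace R) (f : Z -> Y0) (f' : 'I_2 -> Z -> Y0) :
    (forall i, semireg cc (M i) (f' i)) -> (forall i z, M i z -> f z = f' i z) ->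
    semireg cc setT f.
  move=> rf ff'; apply: semireg_loc => // z _; have [i Mz] := cov z.
  by exists (M i), (f' i); split=> //; exact: ff'.
apply: semireg_subspace => //; apply: semireg_prodspace => //.
  apply: semireg_subspace => //; apply: semireg_prodspace => //.
    apply: semireg_prodspace => //.
      apply: (leaf _ _ _ (fun i z => pt (X i z))) => [i|i z /thr/drep_base1].
        by apply: semireg_pt => // [k|z /nz[]//]; exact: rX.
      by rewrite /lbase /dfst => ->.
    apply: (leaf _ _ _ (fun i z => pt (Y i z))) => [i|i z /thr/drep_base1].
      by apply: semireg_pt => // [k|z /nz[]//]; exact: rY.
    by rewrite /lbase /dfst => ->.
  apply: (leaf _ _ _ (fun i z => opt n (X i z) (v i z))) => [i|i z /thr/drep_vec1//].
  by apply: semireg_opt => // [k|z /nz[]//]; exact: rX.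
have cc k (x : 'rV[C]_2) : conjc (conjv x 0 k) = x 0 k by rewrite mxE conjcK.
apply: semireg_conjspace.
apply: semireg_subspace => //; apply: semireg_prodspace => //.
  apply: semireg_prodspace => //.
    apply: (leaf _ _ _ (fun i z => pt (conjv (Y i z)))) => [i|i z /thr/drep_base2].
      apply: semireg_pt => // [k|z /nz[_]]; last by rewrite conjv_eq0.
      by apply: (reg_eq rZ (rY i k)) => z _; exact: cc.
    by rewrite /lbase /dsnd => ->.
  apply: (leaf _ _ _ (fun i z => pt (conjv (X i z)))) => [i|i z /thr/drep_base2].
    apply: semireg_pt => // [k|z /nz[]]; last by rewrite conjv_eq0.
    by apply: (reg_eq rZ (rX i k)) => z _; exact: cc.
  by rewrite /lbase /dsnd => ->.
apply: (leaf _ _ _ (fun i z => opt n (conjv (Y i z)) (conjc (u i z)))) => [i|i z /thr/drep_vec2//].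
apply: semireg_opt => // [k|z /nz[_]|].
- by apply: (reg_eq rZ (rY i k)) => z _; exact: cc.
- by rewrite conjv_eq0.
- by apply: (reg_eq rZ (ru i)) => z _; exact: conjcK.
Qed.

End Inverse.
End TrivializationRegular.

(** * Open subvarieties of a real quotient *)

Section OpenQuotient.
Context (R : realType) (Y : cspace R) (s : real_structure Y).
Context (A : set (rpt (realquot s))).
Hypotheses (rY : ringed Y) (oA : @ropen R (realquot s) A).
Local Notation C := R[i].
Local Notation X := (@ropensub R (realquot s) A).

Definition upstairs : set Y := [set y | A (cls (orbit2 s) y)].

Definition real_ringed_openquot := real_ringed_open (real_ringed_quot s rY) oA.
Local Notation rX := real_ringed_openquot.

Lemma rgeo_upstairs (y : rgeo X) : upstairs (val y).
Proof. exact: (set_mem (valP y)). Qed.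

Lemma rgeo_mk y : upstairs y -> exists y' : rgeo X, val y' = y.
Proof. by move=> h; exists (SigSub (mem_set h)). Qed.

Lemma upstairs_s y : upstairs y -> upstairs (s y).
Proof.
rewrite /upstairs /=.
by have -> : cls (orbit2 s) y = cls (orbit2 s) (s y) by apply/cls_orbit2; right.
Qed.

Lemma image_setT : [set val x | x in [set: rpt X]] = A.
Proof.
apply/seteqP; split=> [_ [x _ <-]|x Ax]; first exact: (set_mem (valP x)).
by exists (SigSub (mem_set Ax)).
Qed.

Lemma ropenT : @ropen R X setT.
Proof.
by change (@ropen R (realquot s) [set val x | x in [set: rpt X]]); rewrite image_setT.
Qed.

Definition above (V : set (rpt X)) : set Y :=
  [set y | [set val x | x in V] (cls (orbit2 s) y)].

Lemma above_rpr V (y : rgeo X) : above V (val y) <-> V (rpr X y).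
Proof. exact: (image_val_set V (rpr X y)). Qed.

Lemma above_setT : above setT = upstairs.
Proof. by rewrite /above image_setT. Qed.

Lemma ropen_above V : copen (above V) -> @ropen R X V.
Proof. by []. Qed.

Lemma above_open V : @ropen R X V -> copen (above V).
Proof. by []. Qed.

Lemma rsec_above V h : creg (above V) h ->
  (forall y, above V y -> h (s y) = conjc (h y)) -> rsec X V (fun y => h (val y)).
Proof. by move=> rh hs; exists h. Qed.

Lemma above_rsec V f : rsec X V f -> exists h, [/\ creg (above V) h,
  forall y, above V y -> h (s y) = conjc (h y) &
  forall y, V (rpr X y) -> f y = h (val y)].
Proof.
move=> [h [[rh hs] fh]]; exists h; split=> // y Vy.
by apply: fh; exact/above_rpr.
Qed.

(** A regular function [h] is f + i g, with f and g invariant under the real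
    structure: [crecip h] is the conjugate of [h] for the real structure on
    functions, and [cre h], [cim h] are its real and imaginary parts. *)
Definition crecip (h : Y -> C) (y : Y) : C := conjc (h (s y)).
Definition cre (h : Y -> C) (y : Y) : C := (h y + crecip h y) / 2.
Definition cim (h : Y -> C) (y : Y) : C := (h y - crecip h y) / (2 * 'i%C).

Lemma i_neq0 : 'i%C != 0 :> C.
Proof. by rewrite -sqrf_eq0 sqr_i oppr_eq0 oner_eq0. Qed.

Lemma cre_cim h y : h y = cre h y + 'i%C * cim h y.
Proof. by have t0 := two_neq0 R; have i0 := i_neq0; rewrite /cre /cim; field. Qed.

Lemma crecipK h y : crecip h (s y) = conjc (h y).
Proof. by rewrite /crecip rsK. Qed.

Lemma conjc_crecip h y : conjc (crecip h y) = h (s y).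
Proof. by rewrite /crecip conjcK. Qed.

Lemma cre_s h y : cre h (s y) = conjc (cre h y).
Proof.
rewrite /cre crecipK rmorphM fmorphV rmorph_nat rmorphD; congr (_ / _).
by rewrite /= conjc_crecip addrC.
Qed.

Lemma conjc_2i : conjc (2 * 'i%C) = - (2 * 'i%C) :> C.
Proof.
by apply/eqP; rewrite mulr_natl mulr2n eq_complex /= addr0 oppr0 !eqxx.
Qed.

Lemma cim_s h y : cim h (s y) = conjc (cim h y).
Proof.
have cV (a b : C) : conjc (a / b) = conjc a / conjc b by rewrite rmorphM fmorphV.
have cB (a b : C) : conjc (a - b) = conjc a - conjc b by rewrite rmorphB.
rewrite /cim crecipK cV cB conjc_2i.
by rewrite conjc_crecip invrN mulrN -mulNr opprB.
Qed.

Lemma crecip_reg h : creg upstairs h -> creg upstairs (crecip h).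
Proof.
move=> rh; have [_ /(_ h rh)] := rs_anti s (reg_open rY rh).
have -> // : s @^-1` upstairs = upstairs.
by apply/seteqP; split=> y; [move/upstairs_s; rewrite rsK|exact: upstairs_s].
Qed.

Lemma cre_reg h : creg upstairs h -> creg upstairs (cre h).
Proof.
move=> rh; apply: (regM rY) (reg_cst rY _ (reg_open rY rh)).
exact: (regD rY) (crecip_reg rh).
Qed.

Lemma cim_reg h : creg upstairs h -> creg upstairs (cim h).
Proof.
move=> rh; apply: (regM rY) (reg_cst rY _ (reg_open rY rh)).
exact: (regB rY) (crecip_reg rh).
Qed.

Lemma cre_sec h : creg upstairs h -> rsec X setT (fun y => cre h (val y)).
Proof.
by move=> rh; apply: rsec_above; [rewrite above_setT; exact: cre_reg|move=> y _; exact: cre_s].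
Qed.

Lemma cim_sec h : creg upstairs h -> rsec X setT (fun y => cim h (val y)).
Proof.
by move=> rh; apply: rsec_above; [rewrite above_setT; exact: cim_reg|move=> y _; exact: cim_s].
Qed.

Lemma complexify_fun h : creg upstairs h -> exists H : complexify X -> C,
  @creg R (complexify X) setT H /\ forall y, H (eval_pt rX y) = h (val y).
Proof.
move=> rh; exists (fun P : cpoint X => cp_ev P (fun y : rgeo X => cre h (val y)) +
  'i%C * cp_ev P (fun y : rgeo X => cim h (val y))).
split; first exact: (complexify_reg rX ropenT (cre_sec rh) (cim_sec rh)).
move=> y; rewrite (cp_ev_pt rX ropenT (cre_sec rh)) // (cp_ev_pt rX ropenT (cim_sec rh)) //.
by rewrite -cre_cim.
Qed.

Definition separated := forall y z, upstairs y -> upstairs z ->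
  (forall h, creg upstairs h -> h y = h z) -> y = z.

(** Real sections separate the same points as regular functions, of which they
    are the real and imaginary parts. *)
Lemma sections_separate (y z : rgeo X) : separated ->
  (forall f, rsec X setT f -> f y = f z) -> y = z.
Proof.
move=> sep e; apply: val_inj; apply: sep => [||h rh]; try exact: rgeo_upstairs.
by rewrite [LHS]cre_cim [RHS]cre_cim (e _ (cre_sec rh)) (e _ (cim_sec rh)).
Qed.

Lemma openquot_eval_inj : separated -> injective (eval_pt rX).
Proof.
move=> sep y z yz; apply: (eval_pt_inj _ yz) => _ ne.
apply: contrapT => /forallNP no; apply: ne; apply: sections_separate => // f rf.
have := no f; move/not_andP => [[]|/contrapT//].
by exists setT; split=> //; exact: ropenT.
Qed.

Lemma semireg_eval (Z : cspace R) (th : Z -> rgeo X) : ringed Z ->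
  @semireg R idfun Z Y setT (fun z => val (th z)) ->
  @semireg R idfun Z (complexify X) setT (fun z => eval_pt rX (th z)).
Proof.
move=> rZ rth; apply: semireg_ratspace => // D h [U [f [g [oU rf rg -> hE]]]].
have [f' [rf' _ ff']] := above_rsec rf; have [g' [rg' _ gg']] := above_rsec rg.
have [o r] := rth _ (reg_open rY rf').
have -> : setT `&` (fun z => eval_pt rX (th z)) @^-1` [set P | U (cp_at P)] =
    setT `&` (fun z => val (th z)) @^-1` above U.
  by apply/seteqP; split=> z [_] /above_rpr.
have rI := @reg_cst _ _ rZ _ 'i%C o.
apply: (reg_eq rZ (regD rZ (r _ rf') (regM rZ rI (r _ rg')))) => z [_ /above_rpr Uz].
by rewrite /= hE // (cp_ev_pt rX oU rf) // (cp_ev_pt rX oU rg) // ff' ?gg'.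
Qed.

End OpenQuotient.

(** ** Pulling back sections along an equivariant map *)

Section Pullback.
Context (R : realType) (Y Y' : cspace R).
Context (s : real_structure Y) (s' : real_structure Y').
Context (A : set (rpt (realquot s))) (A' : set (rpt (realquot s'))).
Context (f : Y -> Y').
Hypotheses (rY : ringed Y) (rY' : ringed Y').
Hypotheses (oA : @ropen R (realquot s) A) (rf : semireg idfun setT f).
Hypotheses (fs : forall y, f (s y) = s' (f y)).
Local Notation X := (@ropensub R (realquot s) A).
Local Notation X' := (@ropensub R (realquot s') A').

Definition pull (U : set (rpt X')) : set (rpt X) :=
  [set c | exists y, cls (orbit2 s) y = val c /\ above U (f y)].

Lemma above_conj (U : set (rpt X')) y : above U (s' y) <-> above U y.
Proof.
rewrite /above /mkset.
by have -> : cls (orbit2 s') (s' y) = cls (orbit2 s') y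
  by apply/esym/cls_orbit2; right.
Qed.

Lemma above_pull U : above (pull U) = upstairs A `&` f @^-1` above U.
Proof.
apply/seteqP; split=> y.
  move=> [c [y' [yc Uy']] cy]; have Ay : upstairs A y.
    by rewrite /upstairs /mkset -cy; exact: (set_mem (valP c)).
  split=> //; move: yc; rewrite cy => /esym/cls_orbit2[<- //|e].
  by move: Uy'; rewrite e /preimage /mkset fs => /above_conj.
move=> [Ay Uy]; exists (SigSub (mem_set (Ay : A (cls (orbit2 s) y)))) => //.
by exists y.
Qed.

Lemma pull_reg U g : creg (above U) g -> creg (above (pull U)) (fun y => g (f y)).
Proof.
move=> rg; have [o /(_ _ rg) r] := rf (reg_open rY' rg).
rewrite setTI in o r; rewrite above_pull.
by apply: (reg_sub rY _ r) => [|y []//]; exact: (openI rY oA o).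
Qed.

Lemma pull_open (U : set (rpt X')) : @ropen R X' U -> @ropen R X (pull U).
Proof.
move=> /above_open oU; apply: ropen_above.
exact: (reg_open rY (pull_reg (reg_cst rY' 0 oU))).
Qed.

Lemma pull_rpr U (z : rgeo X) (y : rgeo X') : val y = f (val z) ->
  pull U (rpr X z) <-> U (rpr X' y).
Proof.
move=> e; apply: iff_trans (iff_sym (above_rpr _ z)) _.
rewrite above_pull /setI /preimage /mkset -e; split=> [[_ /above_rpr //]|Uy].
by split; [exact: rgeo_upstairs|exact/above_rpr].
Qed.

Lemma pull_sec (F : rgeo X -> rgeo X') U g : (forall z, val (F z) = f (val z)) ->
  rsec X' U g -> rsec X (pull U) (fun z => g (F z)).
Proof.
move=> Ff /above_rsec[h [rh hs gh]].
have rX := real_ringed_openquot rY oA.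
have r : rsec X (pull U) (fun z => h (f (val z))).
  apply: (rsec_above (pull_reg rh)) => z; rewrite above_pull => -[_ Uz].
  by rewrite fs hs.
apply: (rsec_loc rX r) => //; first exact: (ropen_above (reg_open rY (pull_reg rh))).
by move=> z /(pull_rpr _ (Ff z)) Uz; rewrite gh // Ff.
Qed.

End Pullback.

(** * The complexification of the bundle over the sphere *)

Section ComplexifiedBundle.
Context (R : realType) (n : nat).
Local Notation C := R[i].
Local Notation L := (Lbundle R n).
Local Notation E := (dsum (qconj R) L).
Local Notation S := (sphere R).
Local Notation swap := (dswap (qconj R) L).
Local Notation dpre := (@rpreimage R (quadric R) (realquot swap) (fib E)).
Local Notation sphV := (rpreimage (rfib (LRbundle R n)) (@sphere_set R)).

Local Notation W := (@ropensub R (realquot swap) sphV).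

Lemma sphere_upstairs : @upstairs R _ (qconj R) (@sphere_set R) = @sph R.
Proof.
apply/seteqP; split=> w.
  move=> [w' [x [/cls_orbit2 ww' e xT]]].
  have : sph w' by rewrite /sph /mkset e chart_pcls.
  by case: ww' => -> //; move/sph_conj.
move=> sw; exists w, (qrepr (val w)); split=> //.
by rewrite -[LHS]qreprK.
Qed.

Lemma sphere_open : @ropen R (quadric R) (@sphere_set R).
Proof. by have := @sph_open R; rewrite -sphere_upstairs. Qed.

Lemma dfst_swap z : dfst (swap z) = dsnd z.
Proof. exact: fst_dswap. Qed.

Lemma dsnd_swap z : dsnd (swap z) = dfst z.
Proof. by []. Qed.

Lemma dproj_swap z : dproj (swap z) = qconj R (dproj z).
Proof. by rewrite /dproj dfst_swap dsnd_base. Qed.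

Lemma rpreimage_cls (B : set (rpt (quadric R))) z :
  dpre B (cls (orbit2 swap) z) <->
  B (cls (orbit2 (qconj R)) (dproj z)).
Proof.
split=> [[w [z' [/fib_E <- /cls_orbit2 e Bz]]]|Bz].
  suff -> : cls (orbit2 (qconj R)) (dproj z) = cls (orbit2 (qconj R)) (dproj z') by [].
  apply/cls_orbit2; case: e => ->; first by left.
  by right; rewrite dproj_swap rsK.
by exists (dproj z), z; split=> //; exact/fib_E.
Qed.

Lemma dsum_upstairs : @upstairs R _ swap sphV = @dsph R n.
Proof.
apply/seteqP; split=> z.
  move=> /rpreimage_cls h; have : @upstairs R _ (qconj R) (@sphere_set R) (dproj z) by [].
  by rewrite sphere_upstairs.
by rewrite /dsph /mkset -sphere_upstairs => h; apply/rpreimage_cls.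
Qed.

Lemma dsum_open : @ropen R (realquot swap) sphV.
Proof. by have := @dsph_open R n; rewrite -dsum_upstairs. Qed.

Local Notation rY1 := (@ringed_quadricC R).
Local Notation rY2 := (@ringed_Etot R n).
Definition real_ringed_sphere := real_ringed_openquot rY1 sphere_open.
Definition real_ringed_total := real_ringed_openquot rY2 dsum_open.
Local Notation rS := real_ringed_sphere.
Local Notation rW := real_ringed_total.

Lemma geoS_sph (y : rgeo S) : sph (val y).
Proof. by rewrite -sphere_upstairs; exact: rgeo_upstairs. Qed.

Lemma geoW_sph (z : rgeo W) : sph (dproj (val z)).
Proof.
have : dsph (val z : tot E) by rewrite -dsum_upstairs; exact: rgeo_upstairs.
by [].
Qed.

Lemma geoS_mk w : sph w -> exists y : rgeo S, val y = w.
Proof. by rewrite -sphere_upstairs; exact: rgeo_mk. Qed.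

Lemma geoW_mk z : sph (dproj z) -> exists z' : rgeo W, val z' = z.
Proof.
by move=> h; apply: rgeo_mk; rewrite dsum_upstairs.
Qed.

Definition evS (y : rgeo S) : cpoint S := eval_pt rS y.
Definition evW (z : rgeo W) : cpoint W := eval_pt rW z.

Lemma separated_S : @separated R _ (qconj R) (@sphere_set R).
Proof.
rewrite /separated sphere_upstairs => y z sy sz e; apply: (scoord_inj sy sz).
by apply/rowP => k; exact: (e _ (scoord_reg R k)).
Qed.

Lemma separated_W : @separated R _ swap sphV.
Proof.
rewrite /separated dsum_upstairs => y z sy sz e; have ep : dproj y = dproj z.
  apply: (scoord_inj sy sz); apply/rowP => k.
  exact: (e _ (scoord_dproj_reg R n k)).
apply: (dcoord_inj sy ep).
by apply/rowP => k; exact: (e _ (dcoord_reg R n k)).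
Qed.

Lemma evS_inj : injective evS.
Proof. exact: (openquot_eval_inj separated_S). Qed.

Lemma evW_inj : injective evW.
Proof. exact: (openquot_eval_inj separated_W). Qed.

Lemma evS_surj P : exists y, evS y = P.
Proof. by have [y ->] := cpoint_eval rS P; exists y. Qed.

Lemma evW_surj P : exists y, evW y = P.
Proof. by have [y ->] := cpoint_eval rW P; exists y. Qed.

Definition gS (P : cpoint S) : rgeo S := projT1 (cid (evS_surj P)).
Definition gW (P : cpoint W) : rgeo W := projT1 (cid (evW_surj P)).

Lemma gSK P : evS (gS P) = P. Proof. by rewrite /gS; case: cid. Qed.
Lemma gWK P : evW (gW P) = P. Proof. by rewrite /gW; case: cid. Qed.
Lemma evSK y : gS (evS y) = y. Proof. by apply: evS_inj; rewrite gSK. Qed.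
Lemma evWK y : gW (evW y) = y. Proof. by apply: evW_inj; rewrite gWK. Qed.

Definition projW (z : rgeo W) : rgeo S := projT1 (cid (geoS_mk (geoW_sph z))).

Lemma val_projW z : val (projW z) = dproj (val z).
Proof. by rewrite /projW; case: cid. Qed.

Lemma theta_ex (y : rgeo S) (c : 'rV[C]_2) : exists z : rgeo W,
  dproj (val z) = val y /\ dcoord (val z) = c.
Proof.
have [z [zy zc]] := @dcoord_surj R n (val y) c (geoS_sph y).
have sz : sph (dproj z) by rewrite zy; exact: geoS_sph.
by have [z' e] := geoW_mk sz; exists z'; rewrite e.
Qed.

Definition theta (y : rgeo S) (c : 'rV[C]_2) : rgeo W := projT1 (cid (theta_ex y c)).

Lemma theta_proj y c : dproj (val (theta y c)) = val y.
Proof. by rewrite /theta; case: cid => ? []. Qed.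

Lemma theta_coord y c : dcoord (val (theta y c)) = c.
Proof. by rewrite /theta; case: cid => ? []. Qed.

Lemma projW_theta y c : projW (theta y c) = y.
Proof. by apply: val_inj; rewrite val_projW theta_proj. Qed.

Lemma geoW_eq (z z' : rgeo W) : projW z = projW z' ->
  dcoord (val z) = dcoord (val z') -> z = z'.
Proof.
move=> e ec; apply: val_inj; apply: dcoord_inj => //; first exact: geoW_sph.
by rewrite -!val_projW e.
Qed.

Local Notation CS := (complexify S).
Local Notation CW := (complexify W).
Local Notation CV := (complexify (rtot (Vbundle R n))).
Local Notation triv := (prodspace CS (affine R 2)).

Definition Phi (v : CW) : triv := (evS (projW (gW v)), dcoord (val (gW v))).
Definition Psi (z : triv) : CW := evW (theta (gS z.1) z.2).

Lemma PhiK : cancel Phi Psi.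
Proof.
move=> v; have e1 : gS (Phi v).1 = projW (gW v) by exact: evSK.
have e : theta (gS (Phi v).1) (Phi v).2 = gW v.
  by apply: geoW_eq; rewrite ?projW_theta ?theta_coord.
exact: (etrans (congr1 evW e) (gWK v)).
Qed.

Lemma PsiK : cancel Psi Phi.
Proof.
move=> z; have e : gW (Psi z) = theta (gS z.1) z.2 by exact: evWK.
by rewrite /Phi e projW_theta theta_coord gSK; case: (z).
Qed.

Lemma ringed_CS : ringed CS. Proof. exact: (ringed_complexify rS). Qed.
Lemma ringed_CW : ringed CW. Proof. exact: (ringed_complexify rW). Qed.

Lemma CS_fun h : creg (@sph R) h -> creg setT (fun P : CS => h (val (gS P))).
Proof.
rewrite -sphere_upstairs => /(complexify_fun rY1 sphere_open)[H [rH HE]].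
apply: (reg_eq ringed_CS rH) => P _; rewrite -[in RHS](gSK P).
exact/esym/HE.
Qed.

Lemma CW_fun h : creg (@dsph R n) h -> creg setT (fun P : CW => h (val (gW P))).
Proof.
rewrite -dsum_upstairs => /(complexify_fun rY2 dsum_open)[H [rH HE]].
apply: (reg_eq ringed_CW rH) => P _; rewrite -[in RHS](gWK P).
exact/esym/HE.
Qed.

Lemma Phi_regular : semireg idfun setT Phi.
Proof.
have rCW := ringed_CW.
apply: semireg_prodspace => //.
  apply: (@semireg_eval R _ _ _ rY1 sphere_open CW (fun v => projW (gW v))) => //.
  apply: semireg_subspace => //.
  apply: (@semireg_eq _ _ _ _ _ _ (fun v : CW => pt (scoord (dproj (val (gW v)))))) => //.
  - exact: openT.
  - apply: semireg_pt => //; first exact: openT.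
    + move=> k; exact: (CW_fun (scoord_dproj_reg R n k)).
    + by move=> v _; apply: hcoord_neq0; exact: geoW_sph.
  - by move=> v _; rewrite val_projW pt_hcoord //; exact: geoW_sph.
apply: semireg_affine => //; first exact: openT.
by move=> k; exact: (CW_fun (dcoord_reg R n k)).
Qed.

Lemma Psi_regular : semireg idfun setT Psi.
Proof.
have rCS := ringed_CS; have rA := ringed_affine R 2.
have rT := ringed_prodspace rCS rA.
apply: (@semireg_eval R _ _ _ rY2 dsum_open triv (fun z => theta (gS z.1) z.2)) => //.
apply: (@semireg_total R n triv (fun z => val (gS z.1)) (fun z => z.2)) => //.
- by move=> z; exact: geoS_sph.
- move=> k; have := CS_fun (scoord_reg R k).
  by move=> /(semireg_reg (semireg_fst rCS rA) (openT rCS)); apply.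
- move=> k; have := affine_coord_reg R k.
  by move=> /(semireg_reg (semireg_snd rCS rA) (openT rA)); apply.
- by move=> z; exact: theta_proj.
- by move=> z; exact: theta_coord.
Qed.

Definition preW : set (rpt S) -> set (rpt W) :=
  @pull R (tot E) (quadricC R) swap (qconj R) sphV (@sphere_set R) (@dproj R n).

Local Notation preW_open :=
  (pull_open rY2 rY1 dsum_open (@semireg_dproj R n) dproj_swap).

Lemma preW_rpr (U : set (rpt S)) z : preW U (rpr W z) <-> U (rpr S (projW z)).
Proof. exact: (pull_rpr dproj_swap U (val_projW z)). Qed.

Lemma preW_sec (U : set (rpt S)) f : rsec S U f ->
  rsec W (preW U) (fun z => f (projW z)).
Proof.
exact: (pull_sec rY2 rY1 dsum_open (@semireg_dproj R n) dproj_swap val_projW).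
Qed.

(** If the C-point at [z] lies over the one at [y], every section on the sphere
    takes the same value at [y] and at the base point of [z]; such sections
    separate points. *)
Lemma lies_overE z y (v : CW) (P : CS) : evW z = v -> evS y = P ->
  @lies_over R S (Vbundle R n) v P <-> projW z = y.
Proof.
move=> <- <-; split=> [[_ h]|<-].
  apply: (sections_separate rY1 separated_S) => f rf.
  have oT : @ropen R S setT := ropenT sphere_open.
  have := h setT f (fun z => f (projW z)) oT I rf.
  rewrite (cp_ev_pt rS oT rf) // (cp_ev_pt rW (preW_open oT) (preW_sec rf)); last exact/preW_rpr.
  apply=> y' z' _ /fib_E e.
  by congr f; apply: val_inj; rewrite val_projW.
split.
  exists (projW z), z; split=> //.
  by apply/fib_E; rewrite val_projW.
move=> U f g oU Uz rf gf.
have rg : rsec W (preW U) g.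
  apply: (rsec_loc rW (preW_sec rf)) => //; first exact: preW_open.
  move=> z' /preW_rpr Uz'; apply: gf => //.
  by apply/fib_E; rewrite val_projW.
rewrite (cp_ev_pt rW (preW_open oU) rg); last exact/preW_rpr.
rewrite (cp_ev_pt rS oU rf) //; apply: gf => //.
by apply/fib_E; rewrite val_projW.
Qed.

Lemma lincomb_swap a z1 z2 z3 : lincomb E a z1 z2 z3 ->
  lincomb E (conjc a) (swap z1) (swap z2) (swap z3).
Proof.
move=> /lincomb_E[[e1 e3] h1 h2]; apply/lincomb_E.
by rewrite !dproj_swap !dfst_swap !dsnd_swap e1 e3 conjcK; split; [split|exact: h2|exact: h1].
Qed.

(** The linear structure of the complexified bundle is only tested on real linear
    functions; the real and imaginary parts of the two coordinates are such, since
    exchanging the summands is conjugate linear. *)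
Lemma coord_rlin k :
  @rlin R S (Vbundle R n) setT (fun z : rgeo W => cre swap (fun z => dcoord z 0 k) (val z)) /\
  @rlin R S (Vbundle R n) setT (fun z : rgeo W => cim swap (fun z => dcoord z 0 k) (val z)).
Proof.
have lin z1 z2 z3 a w : sph w -> fib E w z1 -> lincomb E a z1 z2 z3 ->
    dcoord z3 0 k = a * dcoord z1 0 k + dcoord z2 0 k /\
    crecip swap (fun z => dcoord z 0 k) z3 = a * crecip swap (fun z => dcoord z 0 k) z1 +
      crecip swap (fun z => dcoord z 0 k) z2.
  move=> sw /fib_E e1 l; have [[e12 _] _ _] := (lincomb_E _ _ _ _).1 l.
  have s2 : sph (dproj z2) by rewrite -e12 e1.
  have s2' : sph (dproj (swap z2)) by rewrite dproj_swap; apply/sph_conj.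
  have [_ _ ->] := (lincomb_dcoord _ _ _ s2).1 l.
  have [_ _ e3] := (lincomb_dcoord _ _ _ s2').1 (lincomb_swap l).
  rewrite /crecip e3 !mxE rmorphD rmorphM.
  by split=> //=; rewrite conjcK.
have rc := dcoord_reg R n k; rewrite -dsum_upstairs in rc.
have su w : [set val x | x in [set: rpt S]] (cls (orbit2 (qconj R)) w) -> sph w.
  by rewrite image_setT -sphere_upstairs.
split.
  exists (cre swap (fun z => dcoord z 0 k)); split=> //; split.
    split; last by move=> z _; exact: cre_s.
    by rewrite image_setT; exact: (cre_reg rY2 rc).
  move=> a z1 z2 z3 w /su sw f1 l; have [e1 e2] := lin _ _ _ _ _ sw f1 l.
  by rewrite /cre e1 e2; ring.
exists (cim swap (fun z => dcoord z 0 k)); split=> //; split.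
  split; last by move=> z _; exact: cim_s.
  by rewrite image_setT; exact: (cim_reg rY2 rc).
move=> a z1 z2 z3 w /su sw f1 l; have [e1 e2] := lin _ _ _ _ _ sw f1 l.
by rewrite /cim e1 e2; ring.
Qed.

Lemma above_preW (U : set (rpt S)) :
  @above R _ swap sphV (preW U) = [set z | dpre [set val x | x in U] (cls (orbit2 swap) z)].
Proof.
rewrite /preW (above_pull _ dproj_swap) dsum_upstairs.
apply/seteqP; split=> z; first by move=> [_ Uz]; exact: ((rpreimage_cls _ z).2 Uz).
move=> h; have {}h := (rpreimage_cls _ z).1 h; split=> //.
rewrite /dsph /mkset -sphere_upstairs.
by have [x _ xw] := h; rewrite /upstairs /mkset -xw; exact: (set_mem (valP x)).
Qed.

Lemma rlin_sec (U : set (rpt S)) l : @rlin R S (Vbundle R n) U l ->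
  rsec W (preW U) l.
Proof.
move=> [l' [[[rl sl] _] ll']].
rewrite -[X in creg X l']/([set z | dpre [set val x | x in U] (cls (orbit2 swap) z)]) -above_preW in rl.
have rl' : rsec W (preW U) (fun z => l' (val z)).
  apply: (rsec_above rl) => z; rewrite above_preW; exact: sl.
apply: (rsec_loc rW rl') => //; first exact: (ropen_above (reg_open rY2 rl)).
move=> z /preW_rpr Uz; apply: (ll' (projW z)) => //.
by apply/fib_E; rewrite val_projW.
Qed.

Lemma lincombE a (u v w : rgeo W) (U V V' : CV) :
  evW u = U :> CW -> evW v = V :> CW -> evW w = V' :> CW ->
  lincomb (complexify_bundle (Vbundle R n)) a U V V' <->
  [/\ projW u = projW v, projW w = projW v &
      dcoord (val w) = a *: dcoord (val u) + dcoord (val v)].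
Proof.
move=> <- <- <-; split.
  move=> [s]; have [y <-] := evS_surj s => -[/(lies_overE erefl erefl) <- /(lies_overE erefl erefl) e2 /(lies_overE erefl erefl) e3 h].
  split; [by rewrite e2|by rewrite e3|].
  have oT : @ropen R S setT := ropenT sphere_open.
  have ev l z : @rlin R S (Vbundle R n) setT l -> cp_ev (evW z) l = l z.
    move=> rl; rewrite (cp_ev_pt rW (preW_open oT) (rlin_sec rl)) //.
    exact/preW_rpr.
  apply/rowP => k; rewrite !mxE; have [h1 h2] := coord_rlin k.
  have := h _ _ oT I h2; have := h _ _ oT I h1; rewrite !ev // => {}h1 {}h2.
  have dE (z : rgeo W) := cre_cim swap (fun z => dcoord z 0 k) (val z).
  by rewrite !dE h1 h2; ring.
move=> [e1 e2 ec]; exists (evS (projW v)).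
split; [exact/(lies_overE erefl erefl)|exact/(lies_overE erefl erefl)|exact/(lies_overE erefl erefl)|].
move=> {}U l oU Uv rl; have rs := rlin_sec rl.
have Uv' : U (rpr S (projW v)) by [].
rewrite (cp_ev_pt rW (preW_open oU) rs); last by apply/preW_rpr; rewrite e2.
rewrite (cp_ev_pt rW (preW_open oU) rs); last by apply/preW_rpr; rewrite e1.
rewrite (cp_ev_pt rW (preW_open oU) rs); last exact/preW_rpr.
have [l' [[_ lin] ll']] := rl.
have lE z : projW z = projW v -> l z = l' (val z).
  move=> e; apply: (ll' (projW z)); first by rewrite e.
  by apply/fib_E; rewrite val_projW.
rewrite !lE //; apply: (lin a _ _ _ (dproj (val v))).
- by rewrite -val_projW; exact/(image_val_set U (rpr S (projW v))).
- by apply/fib_E; rewrite -!val_projW e1.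
- apply/lincomb_dcoord; first exact: geoW_sph.
  by rewrite -!val_projW e1 e2.
Qed.

Lemma Phi_fib (P : CS) (v : CV) :
  fib (complexify_bundle (Vbundle R n)) P v <->
  fib (trivial_bundle CS 2) P (Phi v).
Proof.
apply: (iff_trans (@lies_overE (gW v) (gS P) v P (gWK v) (gSK P))).
split=> [e|e]; first exact: (etrans (congr1 evS e) (gSK P)).
by apply: evS_inj; rewrite gSK; exact: e.
Qed.

Lemma Phi_lincomb a (u v w : CV) :
  lincomb (complexify_bundle (Vbundle R n)) a u v w <->
  lincomb (trivial_bundle CS 2) a (Phi u) (Phi v) (Phi w).
Proof.
have h := lincombE a (gWK u) (gWK v) (gWK w); split=> [l|[e1 e2 e3]].
  have [e1 e2 e3] := h.1 l.
  by split; [exact: (congr1 evS e1)|exact: (congr1 evS e2)|exact: e3].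
by apply: h.2; split; [exact: (evS_inj e1)|exact: (evS_inj e2)|exact: e3].
Qed.

End ComplexifiedBundle.

Theorem lemma9 (R : realType) (n : nat) :
  bundle_isomorphic (complexify_bundle (Vbundle R n))
                    (trivial_bundle (complexify (sphere R)) 2).
Proof.
pose F (v : complexify (rtot (Vbundle R n))) := @Phi R n v.
pose G z : complexify (rtot (Vbundle R n)) := @Psi R n z.
exists F, G; split.
- by split; [exact: (@PhiK R n)|exact: (@PsiK R n)].
- split; first exact: (semireg_regular (@Phi_regular R n)).
  exact: (semireg_regular (@Psi_regular R n)).
- exact: (@Phi_fib R n).
- exact: (@Phi_lincomb R n).
Qed.
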